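(* Let $\Sigma$ be a regular fan in $\mathfrak t$ and let $\mathfrak h\subset\mathfrak t_{\mathbb C}$ be a complex subspace satisfying conditions (a) and (b) of the context. Let $M(\Sigma,\mathfrak h)=V_\Sigma/H$, $H=\exp\mathfrak h$, be the corresponding compact complex manifold, and let $\mathcal F$ be its canonical holomorphic foliation. Suppose that the complete fan $q(\Sigma)$ in $\mathfrak t/p(\mathfrak h)$ is weakly normal. Then for any $k\in\mathbb N$ there exists a $C^k$-smooth differential form $\omega_{\mathcal F}$ of type $(1,1)$ on $M(\Sigma,\mathfrak h)$ which is transverse-Kähler with respect to $\mathcal F$ on the open dense $T_{\mathbb C}/H$-orbit.
   Context: Cones and fans: a polyhedral cone is strictly convex if it contains no line. It is regular (with respect to a lattice) if it is spanned by part of a basis of the lattice. A fan is a finite set of strictly convex polyhedral cones closed under taking faces in which any two cones intersect in a common face. A fan is regular if all its cones are regular, and complete if the union of its cones is the whole space. Setting: $T$ is a compact torus with Lie algebra $\mathfrak t$, $N\subset\mathfrak t$ is the lattice dual to the character lattice $N^*\subset\mathfrak t^*$ (so $T=\mathfrak t/N$), $\mathfrak t_{\mathbb C}=\mathfrak t\oplus i\mathfrak t$, and $T_{\mathbb C}=\mathfrak t_{\mathbb C}/N\cong(\mathbb C^* )^{\dim T}$ is the complexified torus with exponential map $\exp:\mathfrak t_{\mathbb C}\to T_{\mathbb C}$. $\Sigma$ is a fan in $\mathfrak t$ regular with respect to $N$, and $V_\Sigma$ is the corresponding non-singular toric variety, containing $T_{\mathbb C}$ as its open dense orbit. Let $p:\mathfrak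 t_{\mathbb C}\to\mathfrak t$ be the projection onto the real part and $q:\mathfrak t\to\mathfrak t/p(\mathfrak h)$ the quotient map. The conditions on the complex subspace $\mathfrak h\subset\mathfrak t_{\mathbb C}$ are: (a) $\mathfrak h\cap\mathfrak t=\{0\}$; (b) $q$ maps $\Sigma$ bijectively onto a complete fan, i.e. $q(\Sigma)=\{q(\sigma):\sigma\in\Sigma\}$ is a complete fan in $\mathfrak t/p(\mathfrak h)$ and $q$ restricts to a bijection from the union of the cones of $\Sigma$ onto $\mathfrak t/p(\mathfrak h)$. Under these conditions $H=\exp\mathfrak h\subset T_{\mathbb C}$ acts freely and properly on $V_\Sigma$, and $M(\Sigma,\mathfrak h):=V_\Sigma/H$ is a compact complex manifold on which $T_{\mathbb C}/H$ acts with an open dense orbit (the image of $T_{\mathbb C}\subset V_\Sigma$). Canonical foliation: let $\overline{\mathfrak h}\subset\mathfrak t_{\mathbb C}$ be the complex conjugate of $\mathfrak h$ with respect to $\mathfrak t_{\mathbb C}=\mathfrak t\oplus i\mathfrak t$. The orbits of $H'=\exp\overline{\mathfrak h}\subset T_{\mathbb C}$ acting on $M(\Sigma,\mathfrak h)$ form a holomorphic foliation $\mathcal F$ of complex dimension $\dim_{\mathbb C}\mathfrak h$, called the canonical foliation. Transverse-Kähler form: a differential $(1,1)$-form $\omega$ on a complex manifold with complex structure $J$ is transverse-Kähler with respect to a holomorphic foliation $\mathcal F$ if $d\omega=0$; $\omega(X,JX)\ge0$ for every tangent vector $X$; and $\omega(X,JX)=0$ if and only if $X$ is tangent to $\mathcal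 F$. Weakly normal fan: let $\Sigma'$ be a complete fan in a real vector space $W$, let $v_1,\dots,v_m$ be vectors generating its one-dimensional cones, and let $b_1,\dots,b_m\in\mathbb R$. For every cone $\sigma\in\Sigma'$ of maximal dimension let $u_\sigma\in W^*$ (the vertex) be the solution of the system $\langle v_i,u_\sigma\rangle+b_i=0$ over all generators $v_i\in\sigma$ (for simplicial $\Sigma'$, as is the case for $q(\Sigma)$, it exists and is unique). The fan $\Sigma'$ is weakly normal if there is a collection $b_1,\dots,b_m$ such that (i) $\langle v_i,u_\sigma\rangle+b_i\ge0$ for every maximal cone $\sigma$ and every $i$; and (ii) the set $\{u\in W^*:\langle v_i,u\rangle+b_i\ge0,\ i=1,\dots,m\}$ has full dimension $\dim W^*$. *)

(* Defs.v *)
From HB Require Import structures.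
From mathcomp Require Import all_boot all_order all_algebra.
From mathcomp Require Import complex.
From mathcomp Require Import all_classical all_reals all_analysis.
Import numFieldNormedType.Exports.

Set Implicit Arguments.
Unset Strict Implicit.
Unset Printing Implicit Defensive.

Import Order.TTheory GRing.Theory Num.Theory.

Local Open Scope classical_set_scope.
Local Open Scope ring_scope.
Local Open Scope complex_scope.

(* [R[i]] gets the norm and topology that exist on every [numFieldType]; thus
   [differentiable], for maps between the spaces ['rV[R[i]]_m], is complex
   differentiability. *)
HB.instance Definition _ (R : realType) := NormedModule.copy R[i] R[i]^o.

Section Fans.
Variables (R : realType) (W : vectType R).
Implicit Types (s t : set W) (Sigma : set (set W)).

Definition cone (g : seq W) : set W :=
  [set x | exists c : 'I_(size g) -> R,
     (forall i, 0 <= c i) /\ x = \sum_(i < size g) c i *: g`_i].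

Definition polyhedral_cone s := exists g : seq W, s = cone g.

Definition strictly_convex s :=
  ~ exists x v : W, v != 0 /\ forall a : R, s (x + a *: v).

(* [face t s]: [t] is a face of [s], cut out by a supporting linear form. *)
Definition face t s := exists u : 'Hom(W, R^o),
  (forall x, s x -> 0 <= (u x : R)) /\ t = [set x | s x /\ u x = 0].

Definition is_fan Sigma := [/\ finite_set Sigma,
  forall s, Sigma s -> polyhedral_cone s /\ strictly_convex s,
  forall s t, Sigma s -> face t s -> Sigma t &
  forall s t, Sigma s -> Sigma t -> face (s `&` t) s /\ face (s `&` t) t].

Definition complete_fan Sigma := \bigcup_(s in Sigma) s = setT.

End Fans.

Definition lin_dim (R : realType) (V : vectType R) (A : set V) (d : nat) :=
  exists U : {vspace V}, [/\ forall x, A x -> x \in U,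
    forall U' : {vspace V}, (forall x, A x -> x \in U') -> (U <= U')%VS
    & \dim U = d].

Definition aff_dim (R : realType) (V : vectType R) (A : set V) (d : nat) :=
  lin_dim [set x - y | x in A & y in A] d.

Section WeaklyNormal.
Variables (R : realType) (W : vectType R) (Sigma : set (set W)).

Definition ray_generators (m : nat) (v : 'I_m -> W) :=
  set_bij setT [set s | Sigma s /\ lin_dim s 1] (fun i => cone [:: v i]).

Definition max_cone (s : set W) := Sigma s /\ exists d, lin_dim s d /\
  forall t e, Sigma t -> lin_dim t e -> (e <= d)%N.

Definition vertex (m : nat) (v : 'I_m -> W) (b : 'I_m -> R) (s : set W)
  (u : 'Hom(W, R^o)) := forall i, s (v i) -> (u (v i) : R) + b i = 0.

Definition polyhedron (m : nat) (v : 'I_m -> W) (b : 'I_m -> R) :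
  set 'Hom(W, R^o) := [set u | forall i, 0 <= (u (v i) : R) + b i].

Definition weakly_normal := exists (m : nat) (v : 'I_m -> W) (b : 'I_m -> R),
  [/\ ray_generators v,
      forall s, max_cone s ->
        exists u, vertex v b s u /\ polyhedron v b u
    & aff_dim (polyhedron v b) (\dim {: 'Hom(W, R^o)})].

End WeaklyNormal.

(* The torus is [T = R^n / Z^n]: [t = 'rV[R]_n], [N = Z^n] and
   [t_C = 'rV[R[i]]_n]. *)
Section Toric.
Variables (R : realType) (n : nat).
Local Notation C := R[i].

(* The cone spanned by the rows [E_j], [j \in I], of [E]. *)
Definition lattice_cone (E : 'M[int]_n) (I : {set 'I_n}) : set 'rV[R]_n :=
  cone [seq map_mx intr (row j E) | j in I].

Definition regular_cone (s : set 'rV[R]_n) := exists E I,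
  E \in unitmx /\ s = lattice_cone E I.

Definition regular_fan (Sigma : set (set 'rV[R]_n)) :=
  is_fan Sigma /\ forall s, Sigma s -> regular_cone s.

Definition cexp (z : C) : C :=
  (expR (complex.Re z))%:C * (cos (complex.Im z) +i* sin (complex.Im z)).

(* [exp : t_C -> T_C = t_C / N], with [t_C / Z^n] identified with [(C^* )^n]
   through [z |-> e^(2 pi i z)]. *)
Definition torus_exp (xi : 'rV[C]_n) : 'rV[C]_n :=
  \row_k cexp ((2 * pi)%:C * 'i * xi 0 k).

(* A point of the toric variety lying in the orbit of the cone [s] is a
   homomorphism [s^perp :&: N^* -> C^*].  It is encoded by the pair of [s] and
   of this homomorphism extended by [0] to [N^* = 'rV[int]_n], i.e. by the
   values at the point of all characters regular on the chart of [s]. *)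
Definition toric_point : Type := (set 'rV[R]_n * ('rV[int]_n -> C))%type.

(* A basis [E] of [N] defines an open part of [C^n] (the union of the affine
   charts [C^I * (C^* )^(~: I)] of the cones of [Sigma] spanned by rows of [E])
   and its embedding in the toric variety.  The value of the character [u] at
   [z] is [\prod_j z_j ^ <u, E_j>]; a negative power of [0] is [0], and the
   zeroth power is [1], so that the product vanishes unless [u] is orthogonal
   to the [E_j] such that [z_j = 0]. *)
Definition zero_cone (E : 'M[int]_n) (z : 'rV[C]_n) : set 'rV[R]_n :=
  lattice_cone E [set j | z 0 j == 0].

Definition toric_dom (Sigma : set (set 'rV[R]_n)) (E : 'M[int]_n) :
    set 'rV[C]_n :=
  [set z | Sigma (zero_cone E z)].

Definition toric_chart (E : 'M[int]_n) (z : 'rV[C]_n) : toric_point :=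
  (zero_cone E z, fun u : 'rV[int]_n => \prod_(j < n) z 0 j ^ (u *m E^T) 0 j).

Definition toric_variety (Sigma : set (set 'rV[R]_n)) : set toric_point :=
  [set x | exists E z,
     [/\ E \in unitmx, toric_dom Sigma E z & x = toric_chart E z]].

Definition torus_act (t : 'rV[C]_n) (x : toric_point) : toric_point :=
  (x.1, fun u : 'rV[int]_n => (\prod_(k < n) t 0 k ^ u 0 k) * x.2 u).

(* The value at [z], in the chart of [E], of the vector field generated by
   [xi]: if [xi = \sum_j c_j E_j], then [exp (a xi)] multiplies [z_j] by
   [e^(2 pi i a c_j)]. *)
Definition fund_field (E : 'M[int]_n) (xi z : 'rV[C]_n) : 'rV[C]_n :=
  \row_j ((2 * pi)%:C * 'i * (xi *m invmx (map_mx intr E)) 0 j * z 0 j).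

Definition real_part (h : {vspace 'rV[C]_n}) : set 'rV[R]_n :=
  [set map_mx (@complex.Re R) z | z in [set z | z \in h]].

Definition h_orbit (h : {vspace 'rV[C]_n}) (x : toric_point) :
    set toric_point :=
  [set torus_act (torus_exp xi) x | xi in [set xi | xi \in h]].

End Toric.

Section Smoothness.
Variables (R : realType) (m : nat).
Local Notation E := 'rV[R[i]]_m.

(* Derivatives along real lines. *)
Definition rderivable (v : E) (g : E -> R) (x : E) :=
  derivable (fun t : R => g (x + t%:C *: v)) 0 1.

Definition rderive (v : E) (g : E -> R) (x : E) : R :=
  derive1 (fun t : R => g (x + t%:C *: v)) 0.

Fixpoint Ck (k : nat) (D : set E) (g : E -> R) : Prop :=
  (forall x, D x -> {for x, continuous g}) /\
  if k is k'.+1 then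
    forall v, (forall x, D x -> rderivable v g x) /\ Ck k' D (rderive v g)
  else True.

(* On the open set [D]: a smooth map whose differentials are complex linear. *)
Definition holomorphic (p : nat) (D : set E) (f : E -> 'rV[R[i]]_p) :=
  (forall x, D x -> differentiable f x) /\
  forall k j, Ck k D (fun x => complex.Re (f x 0 j)) /\
              Ck k D (fun x => complex.Im (f x 0 j)).

End Smoothness.

(* A set with (inverses of) charts, defined on open subsets of [C^m].  That the
   charts cover [space] and have holomorphic transition maps is not part of the
   structure. *)
Record complex_atlas (R : realType) (m : nat) := ComplexAtlas {
  ambient : Type;
  space : set ambient;
  chart : Type;
  dom : chart -> set 'rV[R[i]]_m;
  par : chart -> 'rV[R[i]]_m -> ambient;
  dom_open : forall c, open (dom c);
  par_space : forall c x, dom c x -> space (par c x);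
  par_inj : forall c x y, dom c x -> dom c y -> par c x = par c y -> x = y
}.

Section Forms.
Variables (R : realType) (m : nat) (M : complex_atlas R m).
Local Notation E := 'rV[R[i]]_m.

(* Tangent vectors are represented, in a chart, by elements of [C^m]; the
   complex structure [J] is multiplication by ['i]. *)
Definition two_tensor := chart M -> E -> E -> E -> R.

Definition transition (c c' : chart M) (x : E) (f : E -> E) :=
  exists D : set E, [/\ open D, D x, holomorphic D f &
    forall y, D y -> dom c' (f y) /\ par c' (f y) = par c y].

Definition two_form (w : two_tensor) :=
  [/\ forall c x X X' Y (a : R), dom c x ->
        w c x (a%:C *: X + X') Y = a * w c x X Y + w c x X' Y,
      forall c x X Y, dom c x -> w c x Y X = - w c x X Y
    & forall c c' x f X Y, dom c x -> transition c c' x f ->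
        w c x X Y = w c' (f x) ('d f x X) ('d f x Y)].

(* In each chart, [w] is a combination of the forms [dz_j /\ d(bar z_k)]. *)
Definition type11 (w : two_tensor) := forall c x, dom c x ->
  exists a : 'M[R[i]]_m, forall X Y : E,
    (w c x X Y)%:C = \sum_(j < m) \sum_(k < m)
      a j k * (X 0 j * (Y 0 k)^* - Y 0 j * (X 0 k)^*).

Definition Ck_form (k : nat) (w : two_tensor) :=
  forall c X Y, Ck k (dom c) (fun x => w c x X Y).

Definition closed_form_at (w : two_tensor) (c : chart M) (x : E) :=
  (forall X Y Z, rderivable Z (fun y => w c y X Y) x) /\
  forall X Y Z, rderive X (fun y => w c y Y Z) x
    + rderive Y (fun y => w c y Z X) x + rderive Z (fun y => w c y X Y) x = 0.

(* [F c x] is the tangent space of the foliation at [par c x]. *)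
Definition transverse_kahler_on (U : set (ambient M))
    (F : chart M -> E -> set E) (w : two_tensor) :=
  forall c x, dom c x -> U (par c x) ->
    closed_form_at w c x /\
    forall X, 0 <= w c x X ('i *: X) /\ (w c x X ('i *: X) = 0 <-> F c x X).

End Forms.

Section Quotient.
Variables (R : realType) (n : nat) (Sigma : set (set 'rV[R]_n)).
Variable h : {vspace 'rV[R[i]]_n}.
Local Notation C := R[i].
Local Notation m := (n - \dim h)%N.

(* The complex structure of [V_Sigma / H] is the one for which the projection
   is a holomorphic submersion: its charts are given by the local holomorphic
   slices of the action of [H], i.e. holomorphic maps to [V_Sigma], of
   complementary dimension, transverse to the orbits and meeting each orbit
   at most once. *)
Record slice := Slice {
  slice_basis : 'M[int]_n;
  slice_dom : set 'rV[C]_m;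
  slice_map : 'rV[C]_m -> 'rV[C]_n;
  slice_unit : slice_basis \in unitmx;
  slice_open : open slice_dom;
  slice_in : forall x, slice_dom x -> toric_dom Sigma slice_basis (slice_map x);
  slice_holo : holomorphic slice_dom slice_map;
  slice_transverse : forall x X xi, slice_dom x -> xi \in h ->
    'd slice_map x X = fund_field slice_basis xi (slice_map x) -> X = 0;
  slice_inj : forall x y, slice_dom x -> slice_dom y ->
    h_orbit h (toric_chart slice_basis (slice_map x)) =
    h_orbit h (toric_chart slice_basis (slice_map y)) -> x = y
}.

Definition quotient_space : set (set (toric_point R n)) :=
  [set h_orbit h x | x in toric_variety Sigma].

Definition slice_par (c : slice) (x : 'rV[C]_m) : set (toric_point R n) :=
  h_orbit h (toric_chart (slice_basis c) (slice_map c x)).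

Lemma slice_par_space (c : slice) (x : 'rV[C]_m) :
  slice_dom c x -> quotient_space (slice_par c x).
Proof.
move=> cx; exists (toric_chart (slice_basis c) (slice_map c x)) => //.
exists (slice_basis c), (slice_map c x); split => //.
- exact: slice_unit.
- exact: slice_in.
Qed.

Definition quotient_manifold : complex_atlas R m :=
  ComplexAtlas slice_open slice_par_space slice_inj.

(* The image of [T_C], the open orbit of [V_Sigma]. *)
Definition open_orbit : set (set (toric_point R n)) :=
  [set h_orbit h (toric_chart 1%:M t) |
     t in [set t : 'rV[C]_n | forall k, t 0 k != 0]].

(* Since the tangent space of the quotient is that of [V_Sigma] modulo the
   values of the fields generated by [h], a vector [X] is tangent to the orbit
   of [exp (conj h)] iff its lift is, modulo these values, the value of a field
   generated by some element of [conj h]. *)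
Definition canonical_foliation (c : slice) (x : 'rV[C]_m) : set 'rV[C]_m :=
  [set X | exists eta zeta, [/\ eta \in h, zeta \in h &
    'd (slice_map c) x X =
      fund_field (slice_basis c) (map_mx (@conjc R) eta) (slice_map c x)
      + fund_field (slice_basis c) zeta (slice_map c x)]].

End Quotient.

(* Main.v *)
From HB Require Import structures.
Require Import Defs.
From mathcomp Require Import all_boot all_order all_algebra.
From mathcomp Require Import complex.
From mathcomp Require Import all_classical all_reals all_analysis.
From mathcomp Require Import ring lra.
Import numFieldNormedType.Exports.
Import Order.TTheory GRing.Theory Num.Theory.
Local Open Scope classical_set_scope.
Local Open Scope ring_scope.
Local Open Scope complex_scope.

(* On the open orbit put y = \sum_j log|z_j|^2 E_j, and let the u_s be the
   vertices attached to the maximal cones of q(Sigma).  Up to a scaling of the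
   u_s, the form is the dd^c of log \sum_s exp (2 <u_s, q y>): its Hessian is the
   covariance of the u_s for the weights exp (2 <u_s, q y>), so it is
   nonnegative, and it vanishes exactly on the y with <u_s - u_t, q y> = 0 for
   all s, t, i.e. q y = 0, since weak normality makes the u_s affinely span the
   dual of W.  Translations by Im h = p(h) do not change q y, so the form
   descends to the quotient; and Re h = p(h) means that its kernel is
   h + conj h.  Subtracting from each u_s the support function
   min_t <u_t, ->, which changes the potential by a pluriharmonic function on
   each chart, turns the exponentials into monomials
   \prod_j |z_j|^(2 a_(s,j)) with a_(s,j) >= 0, where for every cone of the fan
   some s has all its exponents zero: the form extends to the boundary, and is
   as smooth as wanted there once the u_s are multiplied by a large constant. *)

(** The local potentials do not agree between charts, so the form is defined in every slice by an
    explicit sum over pairs of vertices, [kform]. It sees the monomials only up to a common factor,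
    and their logarithmic derivatives only through differences; a change of slice preserves exactly
    this data, so gluing is algebra. A potential is used only for closedness, which is asked on the
    open orbit, where no coordinate vanishes. Dividing a monomial by z_j, as a logarithmic
    derivative does, costs one unit of exponent: class C^k is obtained from exponents above k+1 at
    the vanishing coordinates. One scaling must achieve this in all charts at once, although
    infinitely many lattice bases define charts; this is why integrality of the generators matters.
    On the combinatorial side, weak normality speaks of cones of maximal dimension only. It must
    first be shown that these cover the quotient and contain the images of all other cones; both
    rest on the injectivity of q on the support of Sigma. *)

Set Implicit Arguments.
Unset Strict Implicit.
Unset Printing Implicit Defensive.

(** * Derivatives along real lines *)

Section RealLines.
Variables (R : realType) (m : nat).
Local Notation E := 'rV[R[i]]_m.

Lemma real_complex_continuous : continuous (real_complex R : R -> R[i]).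
Proof.
move=> t; apply/cvgrPdist_lt => e e0.
have eR : (complex.Re e)%:C = e by apply: RRe_real; rewrite gtr0_real.
have er0 : 0 < complex.Re e by move: e0; rewrite -eR ltcR.
near=> u.
rewrite -(rmorphB (real_complex R)) /= normc_def /= expr0n addr0 sqrtr_sqr.
rewrite -eR ltcR.
near: u.
exact: (cvgr_dist_lt (F := nbhs t) ).
Unshelve. all: by end_near. Qed.

Lemma Re_continuous : continuous (@complex.Re R : R[i] -> R).
Proof.
move=> z A /nbhs_ballP[e /= e0 eA]; apply/nbhs_ballP.
exists e%:C => /=; first by rewrite ltcR.
move=> u; rewrite /ball /= => zu; apply: eA.
rewrite /ball /= -ltcR -(raddfB (@complex.Re R)).
exact: le_lt_trans (normc_ge_Re _) zu.
Qed.

Lemma line_continuous (x v : E) : continuous (fun t : R => x + t%:C *: v).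
Proof.
move=> t; apply: cvgD; first exact: cvg_cst.
apply: cvgZr_tmp.
exact: real_complex_continuous.
Qed.

Lemma Im_continuous : continuous (@complex.Im R : R[i] -> R).
Proof.
move=> z; have -> : @complex.Im R = @complex.Re R \o ( *%R (- 'i)).
  by apply/funext => -[a b] /=; ring.
apply: continuous_comp; last exact: Re_continuous.
exact: (@mulrl_continuous R[i]).
Qed.

Lemma real_complex_dnbhs :
  (fun t : R => t%:C : R[i]) @ (0 : R)^' --> (0 : R[i])^'.
Proof.
move=> A A0.
have A1 : nbhs ((0 : R)%:C : R[i]) (fun y : R[i] => y != 0 -> A y) by [].
have A2 := @real_complex_continuous 0 _ A1.
apply: (@filterS _ (nbhs (0 : R)) _ _ _ _ A2) => t /= At t0; apply: At.
by rewrite (fmorph_eq0 (real_complex R)).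
Qed.

(** Meant for [phi] the real or the imaginary part. Such a map commutes with real scalars, so the
    real difference quotient is [phi] of the complex one at a real increment, and
    [real_complex_dnbhs] transfers the complex limit. *)
Lemma is_derive_line_diff (p : nat) (f : E -> 'rV[R[i]]_p) (phi : R[i] -> R)
    (x v : E) (j : 'I_p) :
  continuous phi -> (forall a b, phi (a - b) = phi a - phi b) ->
  (forall (t : R) a, phi (t%:C * a) = t * phi a) ->
  differentiable f x ->
  is_derive (0 : R) (1 : R) (fun t : R => phi (f (x + t%:C *: v) 0 j))
    (phi ('d f x v 0 j)).
Proof.
move=> cphi phiB phiZ df.
have dv : derivable f x v by exact: diff_derivable.
rewrite -deriveE//.
set g := fun t : R => _.
suff H : h^-1 *: ((g \o shift 0) (h *: 1) - g 0) @[h --> (0 : R)^'] -->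
    phi ('D_v f x 0 j).
  by apply: DeriveDef; [apply/cvg_ex; exists (phi ('D_v f x 0 j))
    |apply: cvg_lim].
have -> : (fun h : R => h^-1 *: ((g \o shift 0) (h *: 1) - g 0)) =
   (fun h : R => phi ((h%:C^-1 *: ((f \o shift x) (h%:C *: v) - f x)) 0 j)).
  apply/funext => h; rewrite /g /= !mxE -(fmorphV (real_complex R)) phiZ phiB.
  rewrite addr0 [h *: 1]mulr1 (addrC x) (_ : x + 0%:C *: v = x) ?scale0r ?addr0 //. 
apply: (cvg_comp (fun h : R => ((h%:C^-1 *: ((f \o shift x) (h%:C *: v) - f x))) 0 j) phi); last exact: cphi.
apply: (cvg_comp (fun h : R => h%:C^-1 *: ((f \o shift x) (h%:C *: v) - f x))
  (fun M : 'rV[R[i]]_p => M 0 j)); last exact: coord_continuous.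
apply: (cvg_comp (fun h : R => h%:C) (fun k : R[i] => k^-1 *: ((f \o shift x) (k *: v) - f x))).
  exact: real_complex_dnbhs.
exact: dv.
Qed.

Lemma is_derive_line_Re (p : nat) (f : E -> 'rV[R[i]]_p) (x v : E) (j : 'I_p) :
  differentiable f x ->
  is_derive (0 : R) (1 : R) (fun t : R => complex.Re (f (x + t%:C *: v) 0 j))
    (complex.Re ('d f x v 0 j)).
Proof.
apply: is_derive_line_diff; first exact: Re_continuous.
  exact: (raddfB (@complex.Re R)).
by move=> t [a b] /=; rewrite mul0r subr0.
Qed.

Lemma is_derive_line_Im (p : nat) (f : E -> 'rV[R[i]]_p) (x v : E) (j : 'I_p) :
  differentiable f x ->
  is_derive (0 : R) (1 : R) (fun t : R => complex.Im (f (x + t%:C *: v) 0 j))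
    (complex.Im ('d f x v 0 j)).
Proof.
apply: is_derive_line_diff; first exact: Im_continuous.
  exact: (raddfB (@complex.Im R)).
by move=> t [a b] /=; rewrite mul0r addr0.
Qed.

End RealLines.

(** * Calculus of functions of class C^k *)

Section CkTheory.
Variables (R : realType) (m : nat).
Local Notation E := 'rV[R[i]]_m.
Implicit Types (D : set E) (g : E -> R) (v x : E).

Definition is_rderive v g x d :=
  is_derive (0 : R) (1 : R) (fun t : R => g (x + t%:C *: v)) d.

Lemma rderivableP v g x :
  rderivable v g x -> is_rderive v g x (rderive v g x).
Proof.
move=> gx; apply: DeriveDef; first exact: gx.
by rewrite /rderive derive1E.
Qed.

Lemma is_rderiveW v g x d :
  is_rderive v g x d -> rderivable v g x /\ rderive v g x = d.
Proof.
move=> [gx <-]; split; first exact: gx.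
by rewrite /rderive derive1E.
Qed.

Lemma line0 x v : x + (0 : R)%:C *: v = x.
Proof. by rewrite scale0r addr0. Qed.

Lemma near_line D x v : open D -> D x -> \forall t \near (0 : R), D (x + t%:C *: v).
Proof.
move=> Do Dx.
have := @line_continuous R m x v 0; apply; rewrite line0.
exact: open_nbhs_nbhs.
Qed.

Lemma is_rderive_ext D v g g' x d : open D -> D x ->
  (forall y, D y -> g y = g' y) -> is_rderive v g x d -> is_rderive v g' x d.
Proof.
move=> Do Dx gg'; apply: near_eq_is_derive.
apply: filterS (near_line v Do Dx) => t; exact: gg'.
Qed.

Lemma CkW k D g : Ck k.+1 D g -> Ck k D g.
Proof.
elim: k g => [|k IH] g [cg dg]; split => // v.
by have [dv ckv] := dg v; split => //; exact: IH.
Qed.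

Lemma Ck_le k l D g : (k <= l)%N -> Ck l D g -> Ck k D g.
Proof.
move=> /subnK <-; elim: (l - k)%N => // j IH /CkW; exact: IH.
Qed.

Lemma continuous_ext_open D g g' x : open D -> D x ->
  (forall y, D y -> g y = g' y) ->
  {for x, continuous g} -> {for x, continuous g'}.
Proof.
move=> Do Dx gg' gx.
have H : nbhs x (fun y => g' y = g y).
  by apply: filterS (open_nbhs_nbhs (conj Do Dx)) => y /gg'.
have -> : {for x, continuous g'} = ((g' @ nbhs x) --> g x) by rewrite gg'.
move=> A /gx gA.
by apply: filterS2 H gA => y /= ->.
Qed.

Lemma Ck_ext k D g g' : open D -> (forall y, D y -> g y = g' y) ->
  Ck k D g -> Ck k D g'.
Proof.
move=> Do; elim: k g g' => [|k IH] g g' gg' [cg dg]; split.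
- by move=> x Dx; exact: continuous_ext_open gg' (cg x Dx).
- by [].
- by move=> x Dx; exact: continuous_ext_open gg' (cg x Dx).
- move=> v; have [dv ckv] := dg v.
  have H x : D x -> is_rderive v g' x (rderive v g x).
    by move=> Dx; exact: (is_rderive_ext Do Dx gg' (rderivableP (dv x Dx))).
  split; first by move=> x /H /is_rderiveW[].
  by apply: (IH (rderive v g)) => // x /H /is_rderiveW[].
Qed.

Lemma Ck_sub k D D' g : D `<=` D' -> Ck k D' g -> Ck k D g.
Proof.
move=> DD'; elim: k g => [|k IH] g [cg dg]; split => //; try by move=> x /DD'/cg.
move=> v; have [dv ckv] := dg v; split; last exact: IH.
by move=> x /DD'/dv.
Qed.

(** The neighbourhood may depend on the point: the form is analysed near each point according to
    which coordinates vanish there. *)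
Lemma Ck_local k D g :
  (forall x, D x -> exists D', [/\ open D', D' x & Ck k D' g]) -> Ck k D g.
Proof.
elim: k g => [|k IH] g H; split => //.
- by move=> x /H[D' [oD' D'x [cg _]]]; exact: cg.
- by move=> x /H[D' [oD' D'x [cg _]]]; exact: cg.
- move=> v; split.
    by move=> x /H[D' [oD' D'x [_ dg]]]; exact: (dg v).1.
  apply: IH => x /H[D' [oD' D'x [_ dg]]]; exists D'; split => //.
  exact: (dg v).2.
Qed.

(** The inductive step in usable form: a formula [dg] for the derivatives, valid on [D] only, may
    replace the function [rderive v g]. *)
Lemma CkS k D g (dg : E -> E -> R) : open D ->
  (forall x, D x -> {for x, continuous g}) ->
  (forall v x, D x -> is_rderive v g x (dg v x)) ->
  (forall v, Ck k D (dg v)) -> Ck k.+1 D g.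
Proof.
move=> Do cg Hg Hd; split => // v; split.
  by move=> x /(Hg v) /is_rderiveW[].
by apply: Ck_ext (Hd v) => // x /(Hg v)/is_rderiveW[].
Qed.

Lemma Ck_cst k D a : open D -> Ck k D (fun=> a).
Proof.
move=> Do; elim: k a => [|k IH] a; first by split => // x _; exact: cst_continuous.
apply: (@CkS _ _ _ (fun _ _ => 0)) => //.
- by move=> x _; exact: cst_continuous.
- by move=> v x _; exact: is_derive_cst.
Qed.

Lemma Ck_add k D f g : open D -> Ck k D f -> Ck k D g ->
  Ck k D (fun x => f x + g x).
Proof.
move=> Do; elim: k f g => [|k IH] f g [cf df] [cg dg].
  by split => // x Dx; exact: (cvgD (cf x Dx) (cg x Dx)).
apply: (@CkS _ _ _ (fun v x => rderive v f x + rderive v g x)) => //.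
- by move=> x Dx; exact: (cvgD (cf x Dx) (cg x Dx)).
- move=> v x Dx; apply: (@is_deriveD _ _ _ (fun t : R => f (x + t%:C *: v))
    (fun t : R => g (x + t%:C *: v))); apply: rderivableP.
    exact: (df v).1.
  exact: (dg v).1.
- by move=> v; apply: IH; [exact: (df v).2|exact: (dg v).2].
Qed.

Lemma is_rderiveM v f g x a b : is_rderive v f x a -> is_rderive v g x b ->
  is_rderive v (fun x => f x * g x) x (f x * b + a * g x).
Proof.
move=> fa gb.
apply: (@is_derive_eq _ _ _ _ _ _ _ _ (@is_deriveM _ _ (fun t : R => f (x + t%:C *: v))
    (fun t : R => g (x + t%:C *: v)) _ _ _ _ fa gb)).
by rewrite (line0 x v) (mulrC a).
Qed.

Lemma Ck_mul k D f g : open D -> Ck k D f -> Ck k D g ->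
  Ck k D (fun x => f x * g x).
Proof.
move=> Do; elim: k f g => [|k IH] f g [cf df] [cg dg].
  by split => // x Dx; exact: (cvgM (cf x Dx) (cg x Dx)).
apply: (@CkS _ _ _ (fun v x => f x * rderive v g x + rderive v f x * g x)) => //.
- by move=> x Dx; exact: (cvgM (cf x Dx) (cg x Dx)).
- move=> v x Dx; apply: is_rderiveM; apply: rderivableP.
    exact: (df v).1.
  exact: (dg v).1.
- move=> v; apply: Ck_add => //; apply: IH.
  + exact: (@CkW _ _ f).
  + exact: (dg v).2.
  + exact: (df v).2.
  + exact: (@CkW _ _ g).
Qed.

Lemma Ck_sum k D (I : Type) (s : seq I) (P : pred I) (f : I -> E -> R) :
  open D -> (forall i, P i -> Ck k D (f i)) ->
  Ck k D (fun x => \sum_(i <- s | P i) f i x).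
Proof.
move=> Do H; elim: s => [|i s IH].
  by under eq_fun => ? do rewrite big_nil; exact: Ck_cst.
under eq_fun => ? do rewrite big_cons.
by case Pi: (P i) => //; apply: Ck_add => //; exact: H.
Qed.

Lemma Ck_prod k D (I : Type) (s : seq I) (P : pred I) (f : I -> E -> R) :
  open D -> (forall i, P i -> Ck k D (f i)) ->
  Ck k D (fun x => \prod_(i <- s | P i) f i x).
Proof.
move=> Do H; elim: s => [|i s IH].
  by under eq_fun => ? do rewrite big_nil; exact: Ck_cst.
under eq_fun => ? do rewrite big_cons.
by case Pi: (P i) => //; apply: Ck_mul => //; exact: H.
Qed.

Lemma Ck_opp k D f : open D -> Ck k D f -> Ck k D (fun x => - f x).
Proof.
move=> Do cf; under eq_fun => ? do rewrite -mulN1r.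
by apply: Ck_mul => //; exact: Ck_cst.
Qed.

Lemma is_rderive_comp v (F : R -> R) g x a b :
  is_derive (g x) (1 : R) F a -> is_rderive v g x b ->
  is_rderive v (fun x => F (g x)) x (a * b).
Proof.
move=> Fa gb; apply: (@is_derive1_comp _ F (fun t : R => g (x + t%:C *: v))) => //.
by rewrite line0.
Qed.

End CkTheory.

(** * Real powers extended by zero *)

Section RealPower.
Variable R : realType.
Implicit Types x e : R.

(* The value for [e = 0] is [1], also at [x = 0]: a factor with exponent [0] must
   drop out of the monomials below even where the coordinate vanishes. *)
Definition rpow x e : R :=
  if e == 0 then 1 else if 0 < x then expR (e * ln x) else 0.

Lemma rpow0 x : rpow x 0 = 1.
Proof. by rewrite /rpow eqxx. Qed.

Lemma rpow_pos x e : 0 < x -> rpow x e = expR (e * ln x).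
Proof. by rewrite /rpow => ->; case: eqP => // ->; rewrite mul0r expR0. Qed.

Lemma rpow_npos x e : e != 0 -> x <= 0 -> rpow x e = 0.
Proof. by rewrite /rpow => /negPf-> x0; rewrite ltNge x0. Qed.

Lemma rpow_gt0 x e : 0 < x -> 0 < rpow x e.
Proof. by move=> x0; rewrite rpow_pos// expR_gt0. Qed.

Lemma rpow_ge0 x e : 0 <= rpow x e.
Proof. by rewrite /rpow; case: ifP => // _; case: ifP => // _; exact: expR_ge0. Qed.

Lemma rpowD x e f : 0 < x -> rpow x (e + f) = rpow x e * rpow x f.
Proof. by move=> x0; rewrite !rpow_pos// mulrDl expRD. Qed.

Lemma rpowN1 x : 0 < x -> rpow x (- 1) = x^-1.
Proof. by move=> x0; rewrite rpow_pos// mulN1r expRN lnK. Qed.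

Lemma rpow_pred x e : 0 < x -> rpow x (e - 1) = x^-1 * rpow x e.
Proof. by move=> x0; rewrite rpowD// rpowN1// mulrC. Qed.

Lemma near_gt0 x : 0 < x -> \forall y \near x, 0 < y.
Proof.
rewrite -oppr_lt0 => /Nlt_nbhsl; apply: filterS => y.
by rewrite oppr_lt0.
Qed.

Lemma near_lt0 x : x < 0 -> \forall y \near x, y < 0.
Proof. by move=> x0; exact: lt_nbhsl. Qed.

Lemma is_derive_rpow x e : 0 < x ->
  is_derive x 1 (fun y => rpow y e) (e * rpow x (e - 1)).
Proof.
move=> x0.
have H : is_derive x (1 : R) (fun y => expR (e * ln y)) (e * rpow x (e - 1)).
  have dl : is_derive x (1 : R) (fun y => e * ln y) (e * x^-1).
    have := @is_deriveZ _ _ _ (@ln R) e x 1 _ (is_derive1_ln x0).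
    exact.
  apply: is_derive_eq (is_derive1_comp (is_derive_expR _) dl) _.
  by rewrite rpow_pred// rpow_pos// mulrC -mulrA.
apply: near_eq_is_derive H.
by apply: filterS (near_gt0 x0) => y y0; rewrite rpow_pos.
Qed.

Lemma rpow_continuous0 e : 0 < e -> rpow y e @[y --> (0 : R)] --> (0 : R).
Proof.
move=> e0; apply/cvgrPdist_lt => eps eps0.
near=> y; rewrite sub0r normrN ger0_norm ?rpow_ge0//.
have [y0|y0] := ltP 0 y; last by rewrite rpow_npos// gt_eqF.
rewrite rpow_pos// -[ltRHS]lnK// ltr_expR mulrC -ltr_pdivlMr//.
rewrite -ltr_expR lnK//; near: y.
apply: lt_nbhsl; exact: expR_gt0.
Unshelve. all: by end_near. Qed.

(** Only [x = 0] is delicate: there the difference quotient is [rpow h (e - 1)] for [h > 0] and zero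
    for [h < 0], and it tends to zero because [e - 1 > 0]. Extending by zero to negative arguments
    makes the derivative two-sided. *)
Lemma is_derive_rpow_gt1 x e : 1 < e ->
  is_derive x 1 (fun y => rpow y e) (e * rpow x (e - 1)).
Proof.
move=> e1; have [x0|x0|<-] := ltgtP 0 x; first exact: is_derive_rpow.
  have e10 : e - 1 != 0 by rewrite subr_eq0 gt_eqF.
  have e0 : e != 0 by rewrite gt_eqF// (lt_trans _ e1).
  rewrite (rpow_npos e10 (ltW x0)) mulr0.
  apply: near_eq_is_derive (is_derive_cst (0 : R) x 1).
  by apply: filterS (near_lt0 x0) => y /ltW y0; rewrite rpow_npos.
have e0 : e != 0 by rewrite gt_eqF// (lt_trans _ e1).
rewrite rpow_npos ?subr_eq0 ?gt_eqF// mulr0.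
set g := fun y : R => rpow y e.
suff H : h^-1 *: ((g \o shift 0) (h *: (1 : R)) - g 0) @[h --> (0 : R)^'] --> (0 : R).
  by apply: DeriveDef; [apply/cvg_ex; exists 0; exact: H|exact: cvg_lim H].
have H0 : rpow y (e - 1) @[y --> (0 : R)^'] --> (0 : R).
  by apply: cvg_within_filter; apply: rpow_continuous0; rewrite subr_gt0.
apply: cvg_trans H0; apply: near_eq_cvg.
rewrite near_withinE; near=> h => h0.
rewrite /g /= [h *: 1]mulr1 addr0 (rpow_npos (x := 0))// subr0.
have [hp|hp] := ltP 0 h; first by rewrite rpow_pred.
have e10 : e - 1 != 0 by rewrite subr_eq0 gt_eqF.
by rewrite (rpow_npos e0 hp) (rpow_npos e10 hp) [RHS]mulr0.
Unshelve. all: by end_near. Qed.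

Lemma rpow_continuous x e : 0 < e -> {for x, continuous (fun y => rpow y e)}.
Proof.
move=> e0; have [x0|x0|<-] := ltgtP 0 x.
- apply/differentiable_continuous/derivable1_diffP.
  by have [] := is_derive_rpow e x0.
- have e1 : e != 0 by rewrite gt_eqF.
  have H : is_derive x (1 : R) (fun y => rpow y e) 0.
    apply: near_eq_is_derive (is_derive_cst (0 : R) x 1).
    by apply: filterS (near_lt0 x0) => y /ltW y0; rewrite rpow_npos.
  apply/differentiable_continuous/derivable1_diffP.
  by have [] := H.
- rewrite /prop_for /continuous_at (@rpow_npos 0) ?gt_eqF//.
  exact: rpow_continuous0.
Qed.

End RealPower.

Section CkRpow.
Variables (R : realType) (m : nat).
Local Notation E := 'rV[R[i]]_m.
Implicit Types (D : set E) (g : E -> R).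

Lemma Ck_rpow_pos k D g (e : R) : open D -> (forall x, D x -> 0 < g x) ->
  Ck k D g -> Ck k D (fun x => rpow (g x) e).
Proof.
move=> Do g0.
have cont : (forall x, D x -> {for x, continuous g}) ->
    forall x, D x -> {for x, continuous (fun x => rpow (g x) e)}.
  move=> cg x Dx.
  apply: (@continuous_comp _ _ _ g (fun y => rpow y e)); first exact: cg.
  apply/differentiable_continuous/derivable1_diffP.
  by have [] := is_derive_rpow e (g0 x Dx).
elim: k e cont => [|k IH] e cont [cg dg]; first by split => //; exact: cont.
apply: (@CkS _ _ _ _ _ (fun v x => e * rpow (g x) (e - 1) * rderive v g x)) => //.
- exact: cont.
- move=> v x Dx.
  exact: (is_rderive_comp (is_derive_rpow e (g0 x Dx)) (rderivableP ((dg v).1 x Dx))).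
- move=> v; apply: Ck_mul => //; last exact: (dg v).2.
  apply: Ck_mul => //; first exact: Ck_cst.
  apply: IH; last exact: CkW.
  move=> _ x Dx; apply: (@continuous_comp _ _ _ g (fun y => rpow y (e - 1))).
    exact: cg.
  apply/differentiable_continuous/derivable1_diffP.
  by have [] := is_derive_rpow (e - 1) (g0 x Dx).
Qed.

(** Each derivative lowers the exponent by one, so [k < e] still leaves a positive exponent, hence
    continuity, after [k] of them. In contrast with [Ck_rpow_pos], [g] may vanish. *)
Lemma Ck_rpow_gt k D g (e : R) : open D -> k%:R < e ->
  Ck k D g -> Ck k D (fun x => rpow (g x) e).
Proof.
move=> Do.
have cont e' : 0 < e' -> (forall x, D x -> {for x, continuous g}) ->
    forall x, D x -> {for x, continuous (fun x => rpow (g x) e')}.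
  move=> e'0 cg x Dx.
  apply: (@continuous_comp _ _ _ g (fun y => rpow y e')); first exact: cg.
  exact: rpow_continuous.
elim: k e => [|k IH] e ke [cg dg]; first by split => //; exact: cont.
have e1 : 1 < e by apply: le_lt_trans ke; rewrite ler1n.
apply: (@CkS _ _ _ _ _ (fun v x => e * rpow (g x) (e - 1) * rderive v g x)) => //.
- by apply: cont => //; exact: lt_trans e1.
- move=> v x Dx.
  exact: (is_rderive_comp (is_derive_rpow_gt1 (g x) e1) (rderivableP ((dg v).1 x Dx))).
- move=> v; apply: Ck_mul => //; last exact: (dg v).2.
  apply: Ck_mul => //; first exact: Ck_cst.
  apply: IH; last exact: CkW.
  by rewrite ltrBrDr natr1.
Qed.

End CkRpow.

(** * Symmetry of mixed second derivatives *)

Section Schwarz.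
Variables (R : realType) (m : nat).
Local Notation E := 'rV[R[i]]_m.
Implicit Types (D : set E) (g : E -> R) (x v w : E).

Lemma is_derive_line_at g y v (s d : R) :
  is_rderive v g (y + s%:C *: v) d ->
  is_derive s (1 : R) (fun t : R => g (y + t%:C *: v)) d.
Proof.
move=> H.
have H' : is_derive (shift (- s) s) (1 : R)
    (fun t : R => g (y + s%:C *: v + t%:C *: v)) d by rewrite /= subrr.
have -> : (fun t : R => g (y + t%:C *: v)) =
    (fun t : R => g (y + s%:C *: v + t%:C *: v)) \o shift (- s).
  apply/funext => t /=.
  by rewrite -addrA -scalerDl -(rmorphD (real_complex R)) (addrC s) subrK.
by have := is_derive1_comp H' (is_derive_shift s (1 : R) (- s)); rewrite mulr1.
Qed.

Lemma mean_value (f df : R -> R) (h : R) : 0 < h ->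
  (forall s, 0 <= s <= h -> is_derive s (1 : R) f (df s)) ->
  exists2 s, 0 < s < h & f h - f 0 = df s * h.
Proof.
move=> h0 Hf.
have H1 (c : R) : c \in `]0, h[ -> is_derive c (1 : R) f (df c).
  by rewrite in_itv /= => /andP[c0 ch]; apply: Hf; rewrite !ltW.
have H2 : {within `[0, h], continuous f}.
  apply: derivable_within_continuous => c; rewrite in_itv /= => /Hf[Hc _].
  exact: Hc.
have [c] := MVT h0 H1 H2.
by rewrite in_itv /= subr0 => ch Hc; exists c.
Qed.

Definition square x v w (s t : R) : E := x + s%:C *: v + t%:C *: w.

Lemma squareC x v w s t : square x v w s t = square x w v t s.
Proof. by rewrite /square addrAC. Qed.

Fact second_difference_arith (a b c d p q r h : R) :
  a - b - (c - d) = (p - q) * h -> p - q = r * h -> a - b - c + d = r * h * h.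
Proof. by move=> H <-; rewrite -H opprB addrA [RHS]addrAC. Qed.

(** The mean value theorem is applied twice: along [v] to the difference of two opposite sides of
    the square, then along [w] to the derivative in the direction [v]. *)
Lemma second_difference D g x v w (h : R) : Ck 2 D g -> 0 < h ->
  (forall s t, 0 <= s <= h -> 0 <= t <= h -> D (square x v w s t)) ->
  exists s t, [/\ 0 < s < h, 0 < t < h &
    g (square x v w h h) - g (square x v w h 0) - g (square x v w 0 h)
      + g (square x v w 0 0) =
    rderive w (rderive v g) (square x v w s t) * h * h].
Proof.
move=> [_ dg] h0 Dh.
have hh : 0 <= h <= h by rewrite lexx ltW.
have h00 : 0 <= (0 : R) <= h by rewrite lexx ltW.
have [dv [_ ddv]] := dg v.
have [ddw _] := ddv w.
have Hx s t : 0 <= s <= h -> 0 <= t <= h ->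
    is_derive s (1 : R) (fun s => g (square x v w s t))
      (rderive v g (square x v w s t)).
  move=> sh th; rewrite (funext (fun s => congr1 g (squareC x v w s t))) squareC.
  apply: is_derive_line_at; apply: rderivableP; apply: dv.
  by have := Dh s t sh th; rewrite squareC.
have [s sh Hs] := mean_value h0
  (fun s sh => is_deriveB (Hx s h sh hh) (Hx s 0 sh h00)).
have Hy t : 0 <= t <= h ->
    is_derive t (1 : R) (fun t => rderive v g (square x v w s t))
      (rderive w (rderive v g) (square x v w s t)).
  move=> th; apply: is_derive_line_at; apply: rderivableP; apply: ddw.
  by apply: Dh => //; case/andP: sh => s0 s1; rewrite !ltW.
have [t th Ht] := mean_value h0 Hy.
exists s, t; split => //.
exact: second_difference_arith Hs Ht.
Qed.

Fact mixed_difference_arith (a b c d p q h : R) : h != 0 ->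
  a - b - c + d = p * h * h -> a - c - b + d = q * h * h -> p = q.
Proof. by move=> h0; rewrite [a - c - b]addrAC => -> /(mulIf h0)/(mulIf h0). Qed.

(** The second difference is symmetric in [v] and [w], so the two iterated derivatives take equal
    values at two points of an arbitrarily small square; their continuity gives equality at the
    corner [x]. *)
Lemma rderiveC D g x v w : open D -> Ck 2 D g -> D x ->
  rderive v (rderive w g) x = rderive w (rderive v g) x.
Proof.
move=> Do cg Dx.
have [_ dg] := cg.
have [_ [_ ddv]] := dg v; have [_ [_ ddw]] := dg w.
have [_ [ca _]] := ddv w; have [_ [cb _]] := ddw v.
set a := rderive w (rderive v g) in ca *; set b := rderive v (rderive w g) in cb *.
apply/eqP; rewrite -subr_eq0 -normr_le0; apply/ler_addgt0Pl => e e0; rewrite addr0.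
pose P (p : R * R) := square x v w p.1 p.2.
have cP : P @ nbhs ((0, 0) : R * R) --> x.
  have -> : x = P (0, 0) by rewrite /P /square /= !scale0r !addr0.
  apply: cvgD.
    apply: (cvg_comp fst (fun s : R => x + s%:C *: v)); first exact: cvg_fst.
    exact: line_continuous.
  apply: (cvg_comp snd (fun s : R => s%:C *: w)); first exact: cvg_snd.
  apply: cvgZr_tmp; exact: real_complex_continuous.
have e2 : 0 < e / 2 by rewrite divr_gt0.
have N : nbhs x (fun y => [/\ D y, `|a x - a y| < e / 2 & `|b x - b y| < e / 2]).
  have Na : nbhs x (fun y => `|a x - a y| < e / 2).
    by move/cvgrPdist_lt: (ca x Dx); apply.
  have Nb : nbhs x (fun y => `|b x - b y| < e / 2).
    by move/cvgrPdist_lt: (cb x Dx); apply.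
  by apply: filterS3 (open_nbhs_nbhs (conj Do Dx)) Na Nb => y.
have [[A B] [/= /nbhs_ballP[d1 /= d10 A1] /nbhs_ballP[d2 /= d20 B2]] AB] := cP _ N.
pose h := Num.min d1 d2 / 2.
have d0 : 0 < Num.min d1 d2 by rewrite lt_min d10.
have h0 : 0 < h by rewrite divr_gt0.
have hd : h < Num.min d1 d2 by rewrite /h ltr_pdivrMr// ltr_pMr// ltr1n.
have Q s t : 0 <= s <= h -> 0 <= t <= h ->
    [/\ D (square x v w s t), `|a x - a (square x v w s t)| < e / 2
      & `|b x - b (square x v w s t)| < e / 2].
  move=> /andP[s0 sh] /andP[t0 th]; apply: (AB (s, t)); split => /=.
    apply: A1; rewrite /ball /= sub0r normrN ger0_norm//.
    by apply: le_lt_trans sh (lt_le_trans hd _); rewrite ge_min lexx.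
  apply: B2; rewrite /ball /= sub0r normrN ger0_norm//.
  by apply: le_lt_trans th (lt_le_trans hd _); rewrite ge_min lexx orbT.
have [s [t [sh th H1]]] := @second_difference D g x v w h cg h0
  (fun s t sh th => let: And3 H _ _ := Q s t sh th in H).
have [t' [s' [th' sh' H2]]] := @second_difference D g x w v h cg h0
  (fun t s th sh => eq_ind _ D (let: And3 H _ _ := Q s t sh th in H) _ (squareC x v w s t)).
have ab : a (square x v w s t) = b (square x v w s' t').
  rewrite -/b (squareC x w v t' s') (squareC x w v h h) (squareC x w v h 0)
    (squareC x w v 0 h) (squareC x w v 0 0) in H2.
  rewrite -/a in H1.
  exact: mixed_difference_arith (lt0r_neq0 h0) H1 H2.
have lt_le (r : R) : 0 < r < h -> 0 <= r <= h by move=> /andP[? ?]; rewrite !ltW.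
have [_ a1 _] := Q s t (lt_le _ sh) (lt_le _ th).
have [_ _ b1] := Q s' t' (lt_le _ sh') (lt_le _ th').
have -> : b x - a x = (b x - b (square x v w s' t')) - (a x - a (square x v w s t)).
  rewrite ab; move: (b x) (a x) (b _) => p q r; ring.
apply: le_trans (ler_normB _ _) _; rewrite (splitr e).
exact: (lerD (ltW b1) (ltW a1)).
Qed.

End Schwarz.

(** * The form in the coordinates of a toric chart *)

Section ComplexParts.
Variable R : realType.
Local Notation C := R[i].
Implicit Types (z w : C) (t : R).

Definition sqn z : R := complex.Re z ^+ 2 + complex.Im z ^+ 2.

Lemma cReM z w : complex.Re (z * w) =
  complex.Re z * complex.Re w - complex.Im z * complex.Im w.
Proof. by case: z w => [a b] [c d]. Qed.

Lemma cImM z w : complex.Im (z * w) =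
  complex.Re z * complex.Im w + complex.Im z * complex.Re w.
Proof. by case: z w => [a b] [c d]. Qed.

Lemma cReZ t z : complex.Re (t%:C * z) = t * complex.Re z.
Proof. by rewrite cReM /= mul0r subr0. Qed.

Lemma cImZ t z : complex.Im (t%:C * z) = t * complex.Im z.
Proof. by rewrite cImM /= mul0r addr0. Qed.

Lemma sqn_ge0 z : 0 <= sqn z.
Proof. by rewrite addr_ge0 ?sqr_ge0. Qed.

Lemma sqn_eq0 z : (sqn z == 0) = (z == 0).
Proof.
case: z => a b; rewrite paddr_eq0 ?sqr_ge0//= !sqrf_eq0.
by rewrite eq_complex.
Qed.

Lemma sqn_gt0 z : (0 < sqn z) = (z != 0).
Proof. by rewrite lt_neqAle sqn_ge0 andbT eq_sym sqn_eq0. Qed.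

Lemma sqnM z w : sqn (z * w) = sqn z * sqn w.
Proof. by rewrite /sqn cReM cImM; ring. Qed.

Lemma sqn1 : sqn 1 = 1.
Proof. by rewrite /sqn /= expr1n expr0n addr0. Qed.

Lemma cRe_div z w : complex.Re (z / w) =
  (complex.Re z * complex.Re w + complex.Im z * complex.Im w) / sqn w.
Proof. by case: z w => [a b] [c d]; rewrite /sqn /= ?expr2; ring. Qed.

Lemma cIm_div z w : complex.Im (z / w) =
  (complex.Im z * complex.Re w - complex.Re z * complex.Im w) / sqn w.
Proof. by case: z w => [a b] [c d]; rewrite /sqn /= ?expr2; ring. Qed.

Lemma conjCM_Im z w : (complex.Im (z^* * w))%:C =
  'i / 2 * (z * w^* - w * z^*).
Proof.
case: z w => [a b] [c d].
have i2 : 'i / 2 = 0 +i* (1 / 2) :> C.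
  apply: (mulIf (x := 2%:R : C)); first by rewrite pnatr_eq0.
  rewrite divfK ?pnatr_eq0//; apply/eqP; rewrite eq_complex /=; apply/andP.
  by split; apply/eqP; field.
rewrite i2; apply/eqP; rewrite eq_complex /=; apply/andP.
by split; apply/eqP; field.
Qed.

End ComplexParts.

Section KForm.
Variables (R : realType) (n r : nat) (a : 'I_r -> 'I_n -> R).
Local Notation C := R[i].
Implicit Types (z X Y : 'rV[C]_n).

Definition mono z (s : 'I_r) : R := \prod_(j < n) rpow (sqn (z 0 j)) (a s j).

Definition sumsq z : R := \sum_(s < r) mono z s ^+ 2.

(** The logarithmic derivative of the multivalued monomial with factors z_j^(a_(s,j)), whose squared
    modulus is [mono z s]; hence log [mono] has derivative twice the real part of [dlog]. *)
Definition dlog (s : 'I_r) z X : C := \sum_(j < n) (a s j)%:C * (X 0 j / z 0 j).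

(* At the zeros of [z] the junk value [X / 0 = 0] in [dlog] is the right one: there
   the coefficient [a s j - a t j] or the factor [mono z s * mono z t] vanishes. *)
Definition qform (s t : 'I_r) z X : C :=
  (mono z s * mono z t)%:C * (dlog s z X - dlog t z X).

(** With w_s = mono_s^2 / sumsq and d_s = [dlog] s, this is the sum over s, t of w_s w_t Im (conj
    (d_s X - d_t X) (d_s Y - d_t Y)): a covariance written over pairs, so that only differences of
    the d_s occur. *)
Definition kform z X Y : R :=
  (sumsq z ^+ 2)^-1 * \sum_(s < r) \sum_(t < r)
    complex.Im ((qform s t z X)^* * qform s t z Y).

Lemma dlog_linear s z (b : C) X Y :
  dlog s z (b *: X + Y) = b * dlog s z X + dlog s z Y.
Proof.
rewrite /dlog.
have E j : (a s j)%:C * ((b *: X + Y) 0 j / z 0 j) =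
    b * ((a s j)%:C * (X 0 j / z 0 j)) + (a s j)%:C * (Y 0 j / z 0 j).
  by rewrite !mxE; ring.
by rewrite (eq_bigr _ (fun j _ => E j)) big_split mulr_sumr.
Qed.

Lemma qform_linear s t z (b : C) X Y :
  qform s t z (b *: X + Y) = b * qform s t z X + qform s t z Y.
Proof. by rewrite /qform !dlog_linear; ring. Qed.

Lemma qformZ s t z (b : C) X : qform s t z (b *: X) = b * qform s t z X.
Proof.
have q0 : qform s t z 0 = 0.
  have := qform_linear s t z 1 0 0.
  by rewrite scaler0 addr0 mul1r => /eqP; rewrite -subr_eq subrr => /eqP.
by rewrite -[_ *: _]addr0 qform_linear q0 addr0.
Qed.

Lemma kform_linearl z (b : R) X X' Y :
  kform z (b%:C *: X + X') Y = b * kform z X Y + kform z X' Y.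
Proof.
rewrite /kform [b * _]mulrCA -mulrDr; congr (_ * _).
rewrite mulr_sumr -big_split /=.
apply: eq_bigr => s _ /=; rewrite mulr_sumr -big_split /=; apply: eq_bigr => t _ /=.
rewrite qform_linear; move: (qform s t z X) (qform s t z X') (qform s t z Y).
by move=> [? ?] [? ?] [? ?] /=; ring.
Qed.

Lemma kform_alternating z X Y : kform z X Y = - kform z Y X.
Proof.
rewrite /kform -mulrN -sumrN; congr (_ * _).
apply: eq_bigr => s _ /=; rewrite -sumrN; apply: eq_bigr => t _ /=.
by move: (qform s t z X) (qform s t z Y) => [? ?] [? ?] /=; ring.
Qed.

(** [qform] is complex linear, so each summand becomes Im (conj q . i q) = |q|^2. *)
Lemma kform_J z X : kform z X ('i *: X) =
  (sumsq z ^+ 2)^-1 * \sum_(s < r) \sum_(t < r) sqn (qform s t z X).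
Proof.
congr (_ * _); apply: eq_bigr => s _; apply: eq_bigr => t _.
rewrite qformZ; move: (qform s t z X) => [? ?]; rewrite /sqn /=; ring.
Qed.

Lemma kform_J_ge0 z X : 0 <= kform z X ('i *: X).
Proof.
rewrite kform_J mulr_ge0 ?invr_ge0 ?sqr_ge0//.
by apply: sumr_ge0 => s _; apply: sumr_ge0 => t _; exact: sqn_ge0.
Qed.

(** Each summand is Im (conj (l X) l Y) for a complex linear [l]. By [conjCM_Im] this is i/2 times l
    X conj (l Y) - l Y conj (l X), which contributes the coefficients i/2 l_j conj l_k. *)
Lemma kform_type11 (m : nat) (L : {linear 'rV[C]_m -> 'rV[C]_n}) z :
  exists b : 'M[C]_m, forall X Y : 'rV[C]_m,
    (kform z (L X) (L Y))%:C = \sum_(j < m) \sum_(k < m)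
      b j k * (X 0 j * (Y 0 k)^* - Y 0 j * (X 0 k)^*).
Proof.
pose q s t (j : 'I_m) := qform s t z (L (delta_mx 0 j)).
have qE s t (X : 'rV[C]_m) : qform s t z (L X) = \sum_j X 0 j * q s t j.
  rewrite [in LHS](row_sum_delta X) linear_sum /=.
  elim/big_ind2 : _ => [|x1 x2 y1 y2 <- <-|j _].
  - by rewrite -(scale0r (0 : 'rV[C]_n)) qformZ mul0r.
  - by rewrite -[X in qform _ _ _ (X + _)]scale1r qform_linear mul1r.
  - by rewrite linearZ /= qformZ.
exists (\matrix_(j, k) ((sumsq z ^+ 2)^-1%:C * \sum_(s < r) \sum_(t < r)
   ('i / 2 * (q s t j * (q s t k)^*)))) => X Y.
transitivity (((sumsq z ^+ 2)^-1)%:C * \sum_(s < r) \sum_(t < r)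
   \sum_(j < m) \sum_(k < m) ('i / 2 * (q s t j * (q s t k)^*)) *
   (X 0 j * (Y 0 k)^* - Y 0 j * (X 0 k)^*)).
  rewrite /kform rmorphM rmorph_sum; congr (_ * _); apply: eq_bigr => s _.
  rewrite rmorph_sum; apply: eq_bigr => t _.
  rewrite [LHS]conjCM_Im !qE !rmorph_sum /= !mulr_suml -sumrB mulr_sumr.
  apply: eq_bigr => j _; rewrite !mulr_sumr -sumrB mulr_sumr.
  apply: eq_bigr => k _; rewrite !rmorphM; ring.
under [RHS]eq_bigr => j _ do under eq_bigr => k _ do
  rewrite mxE -mulrA mulr_suml.
rewrite mulr_sumr.
under [LHS]eq_bigr => s _ do rewrite mulr_sumr.
under [LHS]eq_bigr => s _ do under eq_bigr => t _ do rewrite mulr_sumr.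
under [LHS]eq_bigr => s _ do under eq_bigr => t _ do under eq_bigr => j _ do rewrite mulr_sumr.
under [RHS]eq_bigr => j _ do under eq_bigr => k _ do rewrite mulr_sumr.
under [RHS]eq_bigr => j _ do under eq_bigr => k _ do under eq_bigr => s _ do rewrite mulr_suml mulr_sumr.
under [LHS]eq_bigr => s _ do rewrite exchange_big.
rewrite exchange_big; apply: eq_bigr => j _ /=.
under [LHS]eq_bigr => s _ do rewrite exchange_big.
by rewrite exchange_big.
Qed.

End KForm.

Section ComplexCk.
Variables (R : realType) (m : nat).
Local Notation C := R[i].
Local Notation E := 'rV[C]_m.
Implicit Types (D : set E) (f g : E -> C).

Definition CkC k D f :=
  Ck k D (fun x => complex.Re (f x)) /\ Ck k D (fun x => complex.Im (f x)).

Lemma CkC_mul k D f g : open D -> CkC k D f -> CkC k D g ->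
  CkC k D (fun x => f x * g x).
Proof.
move=> Do [f1 f2] [g1 g2]; split.
  under eq_fun => x do rewrite cReM.
  apply: Ck_add => //; first exact: Ck_mul.
  by apply: Ck_opp => //; exact: Ck_mul.
under eq_fun => x do rewrite cImM.
by apply: Ck_add => //; exact: Ck_mul.
Qed.

Lemma CkC_real k D (f : E -> R) : open D -> Ck k D f -> CkC k D (fun x => (f x)%:C).
Proof. by move=> Do cf; split => //=; exact: Ck_cst. Qed.

Lemma CkC_conj k D f : open D -> CkC k D f -> CkC k D (fun x => (f x)^*).
Proof.
move=> Do [f1 f2]; split.
  by under eq_fun => x do (rewrite (_ : complex.Re (f x)^* = complex.Re (f x)); last by case: (f x)).
under eq_fun => x do (rewrite (_ : complex.Im (f x)^* = - complex.Im (f x)); last by case: (f x)).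
exact: Ck_opp.
Qed.

Lemma CkC_sum k D (I : Type) (s : seq I) (P : pred I) (f : I -> E -> C) :
  open D -> (forall i, P i -> CkC k D (f i)) ->
  CkC k D (fun x => \sum_(i <- s | P i) f i x).
Proof.
move=> Do H; split.
  under eq_fun => x do rewrite (raddf_sum (@complex.Re R)).
  by apply: Ck_sum => // i /H[].
under eq_fun => x do rewrite (raddf_sum (@complex.Im R)).
by apply: Ck_sum => // i /H[].
Qed.

Lemma CkC_ext k D f g : open D -> (forall x, D x -> f x = g x) ->
  CkC k D f -> CkC k D g.
Proof.
move=> Do fg [f1 f2]; split.
  by apply: Ck_ext f1 => // x /fg ->.
by apply: Ck_ext f2 => // x /fg ->.
Qed.

Lemma CkC_sub k D D' f : D `<=` D' -> CkC k D' f -> CkC k D f.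
Proof. by move=> DD' [f1 f2]; split; apply: Ck_sub DD' _. Qed.

Lemma Ck_sqn k D f : open D -> CkC k D f -> Ck k D (fun x => sqn (f x)).
Proof.
move=> Do [f1 f2]; rewrite /sqn.
under eq_fun => x do rewrite !expr2.
by apply: Ck_add => //; exact: Ck_mul.
Qed.

Lemma near_neq0 k D f x : open D -> CkC k D f -> D x -> f x != 0 ->
  nbhs x (fun y => f y != 0).
Proof.
move=> Do cf Dx; rewrite -sqn_gt0 => fx0.
have [cs _] := Ck_le (leq0n k) (Ck_sqn Do cf).
have H : nbhs x (fun y => 0 < sqn (f y)) by exact: (cs x Dx _ (near_gt0 fx0)).
by apply: filterS H => y; rewrite sqn_gt0.
Qed.

(* Since [0^-1 = 0], this also holds at the zeros of [f], where both sides vanish. *)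
Lemma rpow_div (z : C) (e : R) :
  (rpow (sqn z) e)%:C / z = (rpow (sqn z) (e - 1))%:C * z^*.
Proof.
have [->|z0] := eqVneq z 0; first by rewrite invr0 conjC0 !mulr0.
have s0 : 0 < sqn z by rewrite sqn_gt0.
rewrite rpow_pred//; apply: (mulIf z0); rewrite divfK//.
rewrite -mulrA [_^* * _](_ : _ = (sqn z)%:C); last first.
  rewrite /sqn; case: z {z0 s0} => x y; apply/eqP; rewrite eq_complex /=; apply/andP.
  by split; apply/eqP; ring.
by rewrite -(rmorphM (real_complex R)) mulrAC mulVf ?gt_eqF// mul1r.
Qed.

End ComplexCk.

(** * Smoothness of the form across the coordinate hyperplanes *)

Section Regularity.
Variables (R : realType) (m n r : nat) (a : 'I_r -> 'I_n -> R).
Local Notation C := R[i].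
Local Notation E := 'rV[C]_m.
Variables (D : set E) (f : E -> 'rV[C]_n).
Hypotheses (Do : open D) (hf : holomorphic D f).

Lemma holomorphic_CkC k j : CkC k D (fun x => f x 0 j).
Proof. by have [_ /(_ k j)[]] := hf. Qed.

Lemma is_rderive_Re v x j : D x ->
  is_rderive v (fun x => complex.Re (f x 0 j)) x (complex.Re ('d f x v 0 j)).
Proof. by move=> Dx; apply: is_derive_line_Re; exact: hf.1. Qed.

Lemma is_rderive_Im v x j : D x ->
  is_rderive v (fun x => complex.Im (f x 0 j)) x (complex.Im ('d f x v 0 j)).
Proof. by move=> Dx; apply: is_derive_line_Im; exact: hf.1. Qed.

Lemma holomorphic_diff_CkC k v j : CkC k D (fun x => 'd f x v 0 j).
Proof.
have [_ /(_ k.+1 j)[[_ re] [_ im]]] := hf; split.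
  apply: Ck_ext (re v).2 => // x Dx.
  by have [] := is_rderiveW (is_rderive_Re v j Dx).
apply: Ck_ext (im v).2 => // x Dx.
by have [] := is_rderiveW (is_rderive_Im v j Dx).
Qed.

(** The only danger is 1 / z_j at a zero of z_j. There, either both exponents of the pair are zero,
    and the coefficient [a s j - a t j] vanishes, or one of them exceeds [k.+1]; by [rpow_div] the
    division lowers it by one, which leaves it above [k]. *)
Lemma Ck_kform (k : nat) (X Y : E) :
  (forall x, D x -> 0 < sumsq a (f x)) ->
  (forall x j, D x -> f x 0 j = 0 -> forall s, a s j = 0 \/ k.+1%:R < a s j) ->
  Ck k D (fun x => kform a (f x) ('d f x X) ('d f x Y)).
Proof.
move=> S0 ak; apply: Ck_local => x Dx.
(* On [D'] the coordinates that are nonzero at [x] stay nonzero, so all their powers are smooth. *)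
pose D' := D `&` (interior [set y | forall j, f x 0 j != 0 -> f y 0 j != 0]).
have oD' : open D' by apply: openI => //; exact: open_interior.
exists D'; split => //.
  split => //.
  have nb j : nbhs x (fun y => f x 0 j != 0 -> f y 0 j != 0).
    have [fx0|fx0] := eqVneq (f x 0 j) 0; first by apply: filterS filterT => y.
    have H := near_neq0 Do (holomorphic_CkC 0 j) Dx fx0.
    by apply: filterS H => y.
  exact: filter_forall nb.
have D'D : D' `<=` D by move=> y [].
have cf j : CkC k D' (fun y => f y 0 j) by exact: CkC_sub (holomorphic_CkC k j).
have cdf v j : CkC k D' (fun y => 'd f y v 0 j).
  exact: CkC_sub (holomorphic_diff_CkC k v j).
have cpow j e : (f x 0 j = 0 -> e = 0 \/ k%:R < e) ->
    Ck k D' (fun y => rpow (sqn (f y 0 j)) e).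
  move=> H; have [/H[->|ke]|fx0] := eqVneq (f x 0 j) 0.
  - by under eq_fun => y do rewrite rpow0; exact: Ck_cst.
  - by apply: Ck_rpow_gt => //; exact: Ck_sqn.
  - apply: Ck_rpow_pos => //; last exact: Ck_sqn.
    by move=> y [_ /interior_subset /(_ j fx0)]; rewrite sqn_gt0.
have ck (s : 'I_r) (j : 'I_n) : f x 0 j = 0 -> a s j = 0 \/ k%:R < a s j.
  move=> /(ak x j Dx)/(_ s)[|ka]; [by left|right].
  by apply: lt_trans ka; rewrite ltr_nat.
have cmono (s : 'I_r) : Ck k D' (fun y => mono a (f y) s).
  by apply: Ck_prod => // j _; apply: cpow; exact: ck.
have cinv : Ck k D' (fun y => (sumsq a (f y) ^+ 2)^-1).
  have cS : Ck k D' (fun y => rpow (sumsq a (f y)) (- 1)).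
    apply: Ck_rpow_pos => //; first by move=> y /D'D/S0.
    apply: Ck_sum => // s _; under eq_fun => y do rewrite expr2.
    exact: Ck_mul.
  apply: Ck_ext (Ck_mul oD' cS cS) => // y /D'D/S0 Sy.
  by rewrite rpowN1// expr2 invfM.
have cq (s t : 'I_r) (v : E) : CkC k D' (fun y => qform a s t (f y) ('d f y v)).
  (* Each term is rearranged so that the powers of the j-th coordinate stand next to the division by
     it. *)
  have -> : (fun y => qform a s t (f y) ('d f y v)) = (fun y => \sum_(j < n)
      (((\prod_(i < n | i != j) rpow (sqn (f y 0 i)) (a s i))%:C *
       (\prod_(i < n | i != j) rpow (sqn (f y 0 i)) (a t i))%:C) *
      ((rpow (sqn (f y 0 j)) (a s j))%:C * (rpow (sqn (f y 0 j)) (a t j))%:C *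
      (a s j - a t j)%:C / f y 0 j)) * 'd f y v 0 j).
    apply/funext => y; rewrite /qform /dlog -sumrB mulr_sumr.
    apply: eq_bigr => j _.
    have mE u : mono a (f y) u = rpow (sqn (f y 0 j)) (a u j) *
        \prod_(i < n | i != j) rpow (sqn (f y 0 i)) (a u i).
      by rewrite /mono (bigD1 j).
    by rewrite !mE !rmorphM rmorphB; ring.
  apply: CkC_sum => // j _; apply: CkC_mul => //; apply: CkC_mul => //.
    by apply: CkC_mul => //; apply: CkC_real => //; apply: Ck_prod => // i _;
       apply: cpow; exact: ck.
  have cdiv e : (f x 0 j = 0 -> k%:R < e - 1) ->
      CkC k D' (fun y => (rpow (sqn (f y 0 j)) e)%:C / f y 0 j).
    move=> ke; under eq_fun => y do rewrite rpow_div.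
    apply: CkC_mul; [exact: oD'| |exact: CkC_conj].
    by apply: CkC_real => //; apply: cpow => /ke; right.
  have cr (u : 'I_r) : CkC k D' (fun y => (rpow (sqn (f y 0 j)) (a u j))%:C).
    by apply: CkC_real => //; apply: cpow; exact: ck.
  have cc (d : R) : CkC k D' (fun=> d%:C) by apply: CkC_real => //; exact: Ck_cst.
  have [fx0|fx0] := eqVneq (f x 0 j) 0; last first.
    (* Exponent zero gives the smoothness of 1 / z_j itself; the condition of [cdiv] is vacuous
       since the coordinate is nonzero at [x]. *)
    have := cdiv 0 (fun fx => False_ind _ (negP fx0 (introT eqP fx))).
    under eq_fun => y do rewrite rpow0 div1r.
    move=> ci; apply: CkC_mul => //; apply: CkC_mul => //.
    exact: CkC_mul (cr s) (cr t).
  have kB (e : R) : k.+1%:R < e -> f x 0 j = 0 -> k%:R < e - 1.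
    by rewrite ltrBrDr natr1.
  case: (ak x j Dx fx0 s) => [as0|as1]; last first.
    have := CkC_mul oD' (CkC_mul oD' (cdiv _ (kB _ as1)) (cr t)) (cc (a s j - a t j)).
    apply: CkC_ext => // y _; ring.
  case: (ak x j Dx fx0 t) => [at0|at1]; last first.
    have := CkC_mul oD' (CkC_mul oD' (cdiv _ (kB _ at1)) (cr s)) (cc (a s j - a t j)).
    apply: CkC_ext => // y _; ring.
  apply: CkC_ext (cc 0) => // y _.
  by rewrite as0 at0 subrr mulr0 mul0r.
under eq_fun => y do rewrite /kform.
apply: Ck_mul => //; apply: Ck_sum => // s _; apply: Ck_sum => // t _.
exact: (CkC_mul oD' (CkC_conj oD' (cq s t X)) (cq s t Y)).2.
Qed.

End Regularity.

(** * Closedness off the coordinate hyperplanes *)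

Section RderiveCalculus.
Variables (R : realType) (m : nat).
Local Notation E := 'rV[R[i]]_m.
Implicit Types (g : E -> R) (v x : E).

Lemma is_rderive_eq v g x a b : is_rderive v g x a -> a = b -> is_rderive v g x b.
Proof. by move=> H <-. Qed.

Lemma is_rderive_cst v x (a : R) : is_rderive v (fun=> a) x 0.
Proof. exact: is_derive_cst. Qed.

Lemma is_rderiveD v f g x a b : is_rderive v f x a -> is_rderive v g x b ->
  is_rderive v (fun y => f y + g y) x (a + b).
Proof. exact: is_deriveD. Qed.

Lemma is_rderiveB v f g x a b : is_rderive v f x a -> is_rderive v g x b ->
  is_rderive v (fun y => f y - g y) x (a - b).
Proof. exact: is_deriveB. Qed.

Lemma is_rderive_sum v (I : Type) (s : seq I) (f : I -> E -> R) (df : I -> R) x :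
  (forall i, is_rderive v (f i) x (df i)) ->
  is_rderive v (fun y => \sum_(i <- s) f i y) x (\sum_(i <- s) df i).
Proof.
move=> H; elim: s => [|i s IH].
  under eq_fun => y do rewrite big_nil.
  by rewrite big_nil; exact: is_rderive_cst.
under eq_fun => y do rewrite big_cons.
by rewrite big_cons; exact: is_rderiveD.
Qed.

Lemma is_rderive_prod v (I : Type) (s : seq I) (f : I -> E -> R) (c : I -> R) x :
  (forall i, is_rderive v (f i) x (f i x * c i)) ->
  is_rderive v (fun y => \prod_(i <- s) f i y) x
    ((\prod_(i <- s) f i x) * \sum_(i <- s) c i).
Proof.
move=> H; elim: s => [|i s IH].
  under eq_fun => y do rewrite big_nil.
  by rewrite !big_nil mulr0; exact: is_rderive_cst.
under eq_fun => y do rewrite big_cons.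
apply: is_rderive_eq (is_rderiveM (H i) IH) _.
by rewrite !big_cons; ring.
Qed.

Lemma is_rderiveV v g x a : g x != 0 -> is_rderive v g x a ->
  is_rderive v (fun y => (g y)^-1) x (- (g x)^-2 * a).
Proof.
move=> gx0 H; have g0 : g (x + (0 : R)%:C *: v) != 0 by rewrite line0.
by have := is_deriveV g0 H; rewrite line0.
Qed.

End RderiveCalculus.

Section Covariance.
Variables (R : realType) (r : nat).
Implicit Types (w f g : 'I_r -> R).

(** Twice the covariance of [f] and [g]: it converts the pair sum in [kform] into the expectations
    that appear when weights are differentiated. *)
Lemma sum_pair_diff w f g : \sum_s w s = 1 ->
  \sum_s \sum_t w s * w t * ((f s - f t) * (g s - g t)) =
  2 * (\sum_s w s * (f s * g s) - (\sum_s w s * f s) * (\sum_s w s * g s)).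
Proof.
move=> w1.
have -> : \sum_s \sum_t w s * w t * ((f s - f t) * (g s - g t)) =
  \sum_s \sum_t (w s * (f s * g s) * w t - w s * f s * (w t * g t)
    - w s * g s * (w t * f t) + w s * (w t * (f t * g t))).
  by apply: eq_bigr => s _; apply: eq_bigr => t _; ring.
under eq_bigr => s _ do rewrite !big_split /= !sumrN -!mulr_sumr w1.
rewrite !big_split /= !sumrN -!mulr_suml w1; ring.
Qed.

End Covariance.

Section Closedness.
Variables (R : realType) (m n r : nat) (a : 'I_r -> 'I_n -> R).
Local Notation C := R[i].
Local Notation E := 'rV[C]_m.
Variables (D : set E) (f : E -> 'rV[C]_n).
Hypotheses (Do : open D) (hf : holomorphic D f).
Hypothesis f0 : forall x j, D x -> f x 0 j != 0.
Implicit Types (x v w X Y Z : E).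

Local Notation Alog s v x := (complex.Re (dlog a s (f x) ('d f x v))).
Local Notation Blog s v x := (complex.Im (dlog a s (f x) ('d f x v))).

Lemma sqn_f_gt0 x j : D x -> 0 < sqn (f x 0 j).
Proof. by move=> Dx; rewrite sqn_gt0 f0. Qed.

Lemma is_rderive_sqn v x j : D x ->
  is_rderive v (fun y => sqn (f y 0 j)) x
    (sqn (f x 0 j) * (2 * complex.Re ('d f x v 0 j / f x 0 j))).
Proof.
move=> Dx; have s0 := sqn_f_gt0 j Dx.
have H1 := is_rderive_Re hf v j Dx; have H2 := is_rderive_Im hf v j Dx.
have H := is_rderiveD (is_rderiveM H1 H1) (is_rderiveM H2 H2).
rewrite /sqn; under eq_fun => y do rewrite !expr2.
apply: is_rderive_eq H _; rewrite cRe_div; move: s0; rewrite /sqn.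
move: ('d f x v 0 j) (f x 0 j) => [p1 p2] [z1 z2] /= s0.
by field; rewrite gt_eqF.
Qed.

Lemma is_rderive_rpow v x j e : D x ->
  is_rderive v (fun y => rpow (sqn (f y 0 j)) e) x
    (rpow (sqn (f x 0 j)) e * (2 * (e * complex.Re ('d f x v 0 j / f x 0 j)))).
Proof.
move=> Dx; have s0 := sqn_f_gt0 j Dx.
apply: is_rderive_eq (is_rderive_comp (is_derive_rpow e s0) (is_rderive_sqn v j Dx)) _.
by rewrite rpow_pred//; field; rewrite gt_eqF.
Qed.

Lemma Re_dlog s v x : Alog s v x = \sum_j a s j * complex.Re ('d f x v 0 j / f x 0 j).
Proof. by rewrite raddf_sum /=; apply: eq_bigr => j _; rewrite cReZ. Qed.

Lemma Im_dlog s v x : Blog s v x = \sum_j a s j * complex.Im ('d f x v 0 j / f x 0 j).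
Proof. by rewrite raddf_sum /=; apply: eq_bigr => j _; rewrite cImZ. Qed.

Lemma is_rderive_mono s v x : D x ->
  is_rderive v (fun y => mono a (f y) s) x (mono a (f x) s * (2 * Alog s v x)).
Proof.
move=> Dx.
apply: is_rderive_eq (is_rderive_prod _ (fun j => is_rderive_rpow v j (a s j) Dx)) _.
by rewrite Re_dlog mulr_sumr.
Qed.

Lemma mono_gt0 s x : D x -> 0 < mono a (f x) s.
Proof. by move=> Dx; apply: prodr_gt0 => j _; rewrite rpow_gt0// sqn_f_gt0. Qed.

Definition weight s x : R := mono a (f x) s ^+ 2 / sumsq a (f x).

Lemma sumsq_gt0 (s : 'I_r) x : D x -> 0 < sumsq a (f x).
Proof.
move=> Dx; rewrite /sumsq (bigD1 s)//= ltr_pwDl ?exprn_gt0 ?mono_gt0//.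
by apply: sumr_ge0 => t _; exact: sqr_ge0.
Qed.

(** The derivative of a normalized exponential weight is the weight times the deviation from the
    mean. The factor 4 is 2 from the square of [mono] times 2 from the derivative of log [mono]. *)
Lemma is_rderive_weight s v x : D x ->
  is_rderive v (weight s) x
    (weight s x * (4 * (Alog s v x - \sum_t weight t x * Alog t v x))).
Proof.
move=> Dx; have S0 := sumsq_gt0 s Dx.
have Hm t := is_rderiveM (is_rderive_mono t v Dx) (is_rderive_mono t v Dx).
have HS := is_rderive_sum (index_enum 'I_r) Hm.
have HV := is_rderiveV (g := fun x => \sum_t mono a (f x) t * mono a (f x) t).
have S0' : \sum_t mono a (f x) t * mono a (f x) t != 0.
  rewrite gt_eqF//; under eq_bigr do rewrite -expr2; exact: S0.
have H := is_rderiveM (Hm s) (HV _ _ _ S0' HS).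
rewrite /weight /sumsq; under eq_fun => y do rewrite expr2.
under eq_fun => y do under eq_bigr => t _ do rewrite expr2.
apply: is_rderive_eq H _.
have -> : \sum_t mono a (f x) t * mono a (f x) t = sumsq a (f x).
  by apply: eq_bigr => t _; rewrite expr2.
have -> : \sum_t weight t x * Alog t v x =
   (\sum_t mono a (f x) t ^+ 2 * Alog t v x) / sumsq a (f x).
  by rewrite mulr_suml; apply: eq_bigr => t _; rewrite /weight mulrAC.
have -> : \sum_t (mono a (f x) t * (mono a (f x) t * (2 * Alog t v x)) +
     mono a (f x) t * (2 * Alog t v x) * mono a (f x) t) =
   4 * (\sum_t mono a (f x) t ^+ 2 * Alog t v x).
  by rewrite mulr_sumr; apply: eq_bigr => t _; ring.
rewrite -/(sumsq a (f x)).
move: (\sum_t _) (Alog s v x) (mono _ _ _) (sumsq _ _) S0 => p q u S S0.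
by field; rewrite gt_eqF.
Qed.

(** Im (df_j / f_j) is the differential of the argument of f_j, hence closed. The argument being
    multivalued, this is checked directly from the symmetry of the second derivatives of f_j. *)
Lemma rderive_Im_dlog_coord v w x j : D x -> exists c : R,
  is_rderive v (fun y => complex.Im ('d f y w 0 j / f y 0 j)) x c /\
  is_rderive w (fun y => complex.Im ('d f y v 0 j / f y 0 j)) x c.
Proof.
move=> Dx; have s0 := sqn_f_gt0 j Dx.
have [_ /(_ 2%N j)[re im]] := hf.
have sre u u' : is_rderive u (fun y => complex.Re ('d f y u' 0 j)) x
    (rderive u (rderive u' (fun y => complex.Re (f y 0 j))) x).
  apply: (is_rderive_ext (g := rderive u' (fun y => complex.Re (f y 0 j))) Do Dx).
    by move=> y Dy; have [] := is_rderiveW (is_rderive_Re hf u' j Dy).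
  by apply: rderivableP; have [_ /(_ u')[_ [_ /(_ u)[H _]]]] := re; exact: H.
have sim u u' : is_rderive u (fun y => complex.Im ('d f y u' 0 j)) x
    (rderive u (rderive u' (fun y => complex.Im (f y 0 j))) x).
  apply: (is_rderive_ext (g := rderive u' (fun y => complex.Im (f y 0 j))) Do Dx).
    by move=> y Dy; have [] := is_rderiveW (is_rderive_Im hf u' j Dy).
  by apply: rderivableP; have [_ /(_ u')[_ [_ /(_ u)[H _]]]] := im; exact: H.
have H u u' := is_rderiveM (is_rderiveB
   (is_rderiveM (sim u u') (is_rderive_Re hf u j Dx))
   (is_rderiveM (sre u u') (is_rderive_Im hf u j Dx)))
   (is_rderiveV (lt0r_neq0 s0) (is_rderive_sqn u j Dx)).
have cre := rderiveC v w Do re Dx; have cim := rderiveC v w Do im Dx.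
eexists; split.
  under eq_fun => y do rewrite cIm_div.
  exact: H.
under eq_fun => y do rewrite cIm_div.
apply: is_rderive_eq (H w v) _.
rewrite cre cim !cRe_div.
move: s0; rewrite /sqn.
move: (rderive w _ x) (rderive w _ x) => p q.
move: ('d f x w 0 j) ('d f x v 0 j) (f x 0 j) => [p1 p2] [q1 q2] [z1 z2] /= s0.
by field; rewrite gt_eqF.
Qed.

(* Up to sign and a factor 4, this is the [d^c] of the logarithm of [sumsq]. *)
Definition potential Y x : R := \sum_s weight s x * Blog s Y x.

(** The imaginary parts of the [dlog] are closed, so only the derivatives of the weights survive.
    They give 4 times an antisymmetrized covariance, and [kform] is 2 times the same one. *)
Lemma rderive_potential X Y x : D x ->
  rderive X (potential Y) x - rderive Y (potential X) x =
  2 * kform a (f x) ('d f x X) ('d f x Y).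
Proof.
move=> Dx.
have HB s : {c | is_rderive X (fun y => Blog s Y y) x c /\
     is_rderive Y (fun y => Blog s X y) x c}.
  apply: cid.
  have [c Hc] := choice (fun j => rderive_Im_dlog_coord X Y j Dx).
  have H u j c' g : is_rderive u g x c' -> is_rderive u (fun y => a s j * g y) x (a s j * c').
    move=> Hg; apply: is_rderive_eq (is_rderiveM (is_rderive_cst u x (a s j)) Hg) _.
    by rewrite mul0r addr0.
  exists (\sum_j a s j * c j); split.
    under eq_fun => y do rewrite Im_dlog.
    by apply: is_rderive_sum => j; apply: H; exact: (Hc j).1.
  under eq_fun => y do rewrite Im_dlog.
  by apply: is_rderive_sum => j; apply: H; exact: (Hc j).2.
have [_ H1] := is_rderiveW (is_rderive_sum (index_enum 'I_r) (fun s =>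
  is_rderiveM (is_rderive_weight s X Dx) (svalP (HB s)).1)).
have [_ H2] := is_rderiveW (is_rderive_sum (index_enum 'I_r) (fun s =>
  is_rderiveM (is_rderive_weight s Y Dx) (svalP (HB s)).2)).
have -> : rderive X (potential Y) x = _ := H1.
have -> : rderive Y (potential X) x = _ := H2.
rewrite -sumrB.
transitivity (4 * ((\sum_s weight s x * (Alog s X x * Blog s Y x) -
   (\sum_s weight s x * Alog s X x) * (\sum_s weight s x * Blog s Y x)) -
   (\sum_s weight s x * (Alog s Y x * Blog s X x) -
   (\sum_s weight s x * Alog s Y x) * (\sum_s weight s x * Blog s X x)))).
  rewrite !mulr_sumr -!sumrB mulr_sumr; apply: eq_bigr => s _.
  move: (\sum_t weight t x * Alog t X x) (\sum_t weight t x * Alog t Y x) => P Q.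
  by ring.
have -> : kform a (f x) ('d f x X) ('d f x Y) = \sum_s \sum_t
    (weight s x * weight t x * ((Alog s X x - Alog t X x) * (Blog s Y x - Blog t Y x)) -
     weight s x * weight t x * ((Alog s Y x - Alog t Y x) * (Blog s X x - Blog t X x))).
  rewrite /kform mulr_sumr; apply: eq_bigr => s _.
  rewrite mulr_sumr; apply: eq_bigr => t _; rewrite /qform /weight.
  have := sumsq_gt0 s Dx; move: (sumsq _ _) (mono _ _ _) (mono _ _ _) => S p q S0.
  move: (dlog _ s _ _) (dlog _ s _ _) (dlog _ t _ _) (dlog _ t _ _).
  move=> [? ?] [? ?] [? ?] [? ?] /=.
  by field; rewrite gt_eqF.
under [in RHS]eq_bigr => s _ do rewrite sumrB.
rewrite sumrB.
(* Without any index the weights do not sum to one, but all sums are empty. *)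
have [[s0]|r0] := pselect (inhabited 'I_r); last first.
  have e0 (F : 'I_r -> R) : \sum_s F s = 0.
    by apply: big1 => s; case: r0.
  by rewrite !e0; ring.
have w1 : \sum_s weight s x = 1.
  by rewrite /weight -mulr_suml divff// gt_eqF//; exact: sumsq_gt0.
by rewrite !sum_pair_diff//; ring.
Qed.

Lemma Ck_weight k s : Ck k D (weight s).
Proof.
have cm t : Ck k D (fun y => mono a (f y) t ^+ 2).
  under eq_fun => y do rewrite expr2.
  have H : Ck k D (fun y => mono a (f y) t).
    apply: Ck_prod => // j _; apply: Ck_rpow_pos => //.
      by move=> y Dy; exact: sqn_f_gt0.
    by apply: Ck_sqn => //; exact: holomorphic_CkC.
  exact: Ck_mul.
have cS : Ck k D (fun y => rpow (sumsq a (f y)) (- 1)).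
  apply: Ck_rpow_pos => //; first by move=> y; exact: sumsq_gt0.
  exact: Ck_sum.
apply: Ck_ext (Ck_mul Do (cm s) cS) => // y Dy.
by rewrite rpowN1//; exact: sumsq_gt0.
Qed.

Lemma Ck_potential k Y : Ck k D (potential Y).
Proof.
apply: Ck_sum => // s _; apply: Ck_mul => //; first exact: Ck_weight.
have H : CkC k D (fun y => dlog a s (f y) ('d f y Y)).
  apply: CkC_sum => // j _; apply: CkC_mul => //.
    by apply: CkC_real => //; exact: Ck_cst.
  apply: CkC_mul => //; first exact: holomorphic_diff_CkC.
  have c1 : CkC k D (fun y => (rpow (sqn (f y 0 j)) (- 1))%:C * (f y 0 j)^*).
    apply: CkC_mul => //; last by apply: CkC_conj => //; exact: holomorphic_CkC.
    apply: CkC_real => //; apply: Ck_rpow_pos => //.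
      by move=> y Dy; exact: sqn_f_gt0.
    by apply: Ck_sqn => //; exact: holomorphic_CkC.
  apply: CkC_ext c1 => // y Dy.
  by rewrite -[- 1]sub0r -rpow_div rpow0 mul1r.
exact: H.2.
Qed.

(** The form is half the exterior derivative of [potential], so the cyclic sum is d of d and cancels
    in pairs by [rderiveC]. *)
Lemma kform_closed x : D x ->
  (forall X Y Z, rderivable Z (fun y => kform a (f y) ('d f y X) ('d f y Y)) x) /\
  forall X Y Z,
    rderive X (fun y => kform a (f y) ('d f y Y) ('d f y Z)) x
    + rderive Y (fun y => kform a (f y) ('d f y Z) ('d f y X)) x
    + rderive Z (fun y => kform a (f y) ('d f y X) ('d f y Y)) x = 0.
Proof.
move=> Dx.
have H X Y Z : is_rderive Z (fun y => kform a (f y) ('d f y X) ('d f y Y)) x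
    (2^-1 * (rderive Z (rderive X (potential Y)) x
       - rderive Z (rderive Y (potential X)) x)).
  have D1 U V : is_rderive Z (rderive U (potential V)) x
      (rderive Z (rderive U (potential V)) x).
    apply: rderivableP.
    by have [_ /(_ U)[_ [_ /(_ Z)[d _]]]] := Ck_potential 2 V; exact: d.
  have D2 := is_rderiveM (is_rderive_cst Z x (2^-1 : R)) (is_rderiveB (D1 X Y) (D1 Y X)).
  apply: (is_rderive_ext (g := fun y => 2^-1 * (rderive X (potential Y) y
      - rderive Y (potential X) y)) Do Dx).
    by move=> y Dy; rewrite (rderive_potential X Y Dy) mulKf.
  by apply: is_rderive_eq D2 _; rewrite mul0r addr0.
split=> X Y Z; first by have [] := is_rderiveW (H X Y Z).
have [_ ->] := is_rderiveW (H Y Z X).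
have [_ ->] := is_rderiveW (H Z X Y).
have [_ ->] := is_rderiveW (H X Y Z).
have C U V W := rderiveC U V Do (Ck_potential 2 W) Dx.
have arith (p q u p' q' u' : R) : p = p' -> q = q' -> u = u' ->
    2^-1 * (p - q) + 2^-1 * (u - p') + 2^-1 * (q' - u') = 0.
  by move=> -> -> ->; ring.
exact: arith (C X Y Z) (C X Z Y) (C Y Z X).
Qed.

End Closedness.

(** * Characters and changes of charts *)

Section Excess.
Variables (R : realType) (n r : nat) (L : 'M[R]_(n, r)).
Implicit Types (x : 'rV[R]_n) (s t : 'I_r).

(* The form [s] minus the support function [min_t]. *)
Definition excess s x : R :=
  \big[Num.max/0]_(t < r) ((x *m L) 0 s - (x *m L) 0 t).

Lemma excess_ge0 s x : 0 <= excess s x.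
Proof. exact: bigmax_ge_id. Qed.

Lemma excess_ge s t x : (x *m L) 0 s - (x *m L) 0 t <= excess s x.
Proof. exact: (le_bigmax _ (fun t => (x *m L) 0 s - (x *m L) 0 t)). Qed.

Lemma excess_le s x (c : R) : 0 <= c ->
  (forall t, (x *m L) 0 s - (x *m L) 0 t <= c) -> excess s x <= c.
Proof. by move=> c0 H; apply: bigmax_le. Qed.

Lemma excess_eq0 s x :
  (forall t, (x *m L) 0 s <= (x *m L) 0 t) -> excess s x = 0.
Proof.
move=> H; apply/eqP; rewrite eq_le excess_ge0 andbT.
by apply: excess_le => // t; rewrite subr_le0.
Qed.

Lemma excess0_le s x t : excess s x = 0 -> (x *m L) 0 s <= (x *m L) 0 t.
Proof. by move=> H; rewrite -subr_le0 -H excess_ge. Qed.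

(** The common support function cancels: each excess is only piecewise linear, but their differences
    are linear. *)
Lemma excessB s t x : excess s x - excess t x = (x *m L) 0 s - (x *m L) 0 t.
Proof.
have H s' t' : excess s' x <= (x *m L) 0 s' - (x *m L) 0 t' + excess t' x.
  apply: excess_le => [|u].
    by have := excess_ge t' s' x; lra.
  by have := excess_ge t' u x; lra.
by have := H s t; have := H t s; lra.
Qed.

End Excess.

Section ConeGenerators.
Variables (R : realType) (W : vectType R).

Lemma cone_mem (g : seq W) x : x \in g -> cone g x.
Proof.
move=> xg; have ig : (index x g < size g)%N by rewrite index_mem.
exists (fun i => (i == Ordinal ig)%:R); split; first by move=> i; exact: ler0n.
rewrite (bigD1 (Ordinal ig))//= eqxx scale1r nth_index// big1 ?addr0// => i /negPf->.
by rewrite scale0r.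
Qed.

Lemma cone_ge0 (g : seq W) (phi : W -> R) x :
  phi 0 = 0 -> (forall c y z, phi (c *: y + z) = c * phi y + phi z) ->
  (forall y, y \in g -> 0 <= phi y) -> cone g x -> 0 <= phi x.
Proof.
move=> phi0 phiD gphi [c [c0 ->]].
elim/big_rec : _ => [|i y _ y0]; first by rewrite phi0.
by rewrite phiD addr_ge0// mulr_ge0// gphi// mem_nth.
Qed.

End ConeGenerators.

Section LatticeRows.
Variables (R : realType) (n : nat).
Implicit Types (E : 'M[int]_n) (I : {set 'I_n}).

Definition lrow E j : 'rV[R]_n := map_mx intr (row j E).

Lemma lattice_cone_mem E I j : j \in I -> lattice_cone E I (lrow E j).
Proof. by move=> jI; apply: cone_mem; apply: map_f; rewrite mem_enum. Qed.

Lemma lattice_cone_ge0 E I (phi : 'rV[R]_n -> R) x :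
  phi 0 = 0 -> (forall c y z, phi (c *: y + z) = c * phi y + phi z) ->
  (forall j, j \in I -> 0 <= phi (lrow E j)) -> lattice_cone E I x -> 0 <= phi x.
Proof.
move=> phi0 phiD H; apply: cone_ge0 => // y /mapP[j]; rewrite mem_enum => jI ->.
exact: H.
Qed.

Lemma lrow_mul E (p : nat) (L : 'M[R]_(n, p)) j s :
  (lrow E j *m L) 0 s = (map_mx intr E *m L) j s.
Proof. by rewrite /lrow map_row -row_mul mxE. Qed.

End LatticeRows.

Section Characters.
Variable R : realType.
Local Notation C := R[i].

Definition lnsq (z : C) : R := ln (sqn z).

Lemma lnsq1 : lnsq 1 = 0.
Proof. by rewrite /lnsq sqn1 ln1. Qed.

Lemma lnsqM (z w : C) : z != 0 -> w != 0 -> lnsq (z * w) = lnsq z + lnsq w.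
Proof. by move=> z0 w0; rewrite /lnsq sqnM lnM// posrE sqn_gt0. Qed.

Lemma lnsqV (z : C) : z != 0 -> lnsq z^-1 = - lnsq z.
Proof.
move=> z0; apply/eqP; rewrite -addr_eq0 -lnsqM ?invr_eq0//.
by rewrite mulVf// lnsq1.
Qed.

Lemma lnsqX (z : C) (k : nat) : z != 0 -> lnsq (z ^+ k) = k%:R * lnsq z.
Proof.
move=> z0; elim: k => [|k IH]; first by rewrite expr0 mul0r lnsq1.
by rewrite exprS lnsqM ?expf_neq0// IH -natr1; ring.
Qed.

Lemma lnsq_expz (z : C) (k : int) : (z = 0 -> k = 0) ->
  lnsq (z ^ k) = k%:~R * lnsq z.
Proof.
have [-> /(_ erefl)->|z0 _] := eqVneq z 0; first by rewrite expr0z lnsq1 mul0r.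
case: k => k; first by rewrite lnsqX.
have -> : z ^ Negz k = (z ^+ k.+1)^-1 by [].
by rewrite lnsqV ?expf_neq0// lnsqX// NegzE mulrNz mulNr.
Qed.

Lemma lnsq_prod (I : finType) (F : I -> C) : (forall i, F i != 0) ->
  lnsq (\prod_i F i) = \sum_i lnsq (F i).
Proof.
move=> F0; suff [_ ->] : \prod_i F i != 0 /\ lnsq (\prod_i F i) = \sum_i lnsq (F i) by [].
elim/big_ind2 : _ => [|x1 x2 y1 y2 [h1 h2] [h3 h4]|i _]; last by [].
  by rewrite oner_eq0 lnsq1.
by rewrite mulf_neq0// lnsqM// h2 h4.
Qed.

Lemma cexp_neq0 (z : C) : cexp z != 0.
Proof.
rewrite -sqn_gt0 /cexp sqnM /sqn /= expr0n addr0 cos2Dsin2 mulr1.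
by rewrite exprn_gt0// expR_gt0.
Qed.

Lemma lnsq_cexp (z : C) : lnsq (cexp z) = 2 * complex.Re z.
Proof.
rewrite /lnsq /cexp sqnM /sqn /= expr0n addr0 cos2Dsin2 mulr1 lnXn ?expR_gt0//.
by rewrite expRK mulr_natl.
Qed.

Lemma cexp0 : cexp (0 : C) = 1.
Proof. by rewrite /cexp /= expR0 cos0 sin0 mul1r. Qed.

End Characters.

Section Orbits.
Variables (R : realType) (n : nat) (h : {vspace 'rV[R[i]]_n}).
Local Notation C := R[i].
Implicit Types (E : 'M[int]_n) (z : 'rV[C]_n).

Lemma torus_act0 (x : toric_point R n) : torus_act (torus_exp 0) x = x.
Proof.
case: x => s F; rewrite /torus_act /=; congr pair; apply/funext => u.
rewrite big1 ?mul1r// => k _; rewrite !mxE mulr0 cexp0; exact: exp1rz.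
Qed.

(** The second orbit contains its base point, through the zero element of [h], so that point is a
    translate of the first one; translation keeps the cone and multiplies the characters. *)
Lemma h_orbit_eq E E' z z' :
  h_orbit h (toric_chart E z) = h_orbit h (toric_chart E' z') ->
  zero_cone E' z' = zero_cone E z /\ exists2 xi, xi \in h &
    forall u : 'rV[int]_n, \prod_(l < n) z' 0 l ^ (u *m E'^T) 0 l =
      (\prod_(k < n) torus_exp xi 0 k ^ u 0 k) *
      \prod_(j < n) z 0 j ^ (u *m E^T) 0 j.
Proof.
move=> H; have : h_orbit h (toric_chart E' z') (toric_chart E' z').
  by exists 0; [exact: mem0v|exact: torus_act0].
rewrite -H => -[xi hxi [Hc Hv]]; split; first by rewrite Hc.
exists xi; first exact: hxi.
by move=> u; rewrite -[LHS](congr1 (fun F => F u) Hv).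
Qed.

Lemma lnsq_torus_exp (xi : 'rV[C]_n) (u : 'rV[int]_n) :
  lnsq (\prod_(k < n) torus_exp xi 0 k ^ u 0 k) =
  - (4 * pi * \sum_(k < n) complex.Im (xi 0 k) * (u 0 k)%:~R).
Proof.
rewrite lnsq_prod => [|k]; last by rewrite expfz_neq0// mxE cexp_neq0.
rewrite mulr_sumr -sumrN; apply: eq_bigr => k _.
rewrite lnsq_expz => [|]; last by rewrite mxE => /eqP; rewrite (negPf (cexp_neq0 _)).
by rewrite mxE lnsq_cexp; case: (xi 0 k) => p q /=; ring.
Qed.

(** The character that is 1 on the j-th row of [E] and 0 on the others; in the chart of [E] it is
    the coordinate z_j. *)
Definition dual_row E j : 'rV[int]_n := row j (invmx E)^T.

Lemma dual_row_mul E j : E \in unitmx -> dual_row E j *m E^T = delta_mx 0 j.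
Proof. by move=> uE; rewrite /dual_row -row_mul -trmx_mul mulmxV// trmx1 row1. Qed.

Lemma prod_delta z j : \prod_(l < n) z 0 l ^ (delta_mx 0 j : 'rV[int]_n) 0 l = z 0 j.
Proof.
rewrite (bigD1 j)//= big1 ?mulr1; first by rewrite mxE !eqxx expr1z.
by move=> l /negPf lj; rewrite mxE lj andbF expr0z.
Qed.

Lemma open_orbit_neq0 E z (t : 'rV[C]_n) : E \in unitmx ->
  (forall k, t 0 k != 0) ->
  h_orbit h (toric_chart 1%:M t) = h_orbit h (toric_chart E z) ->
  forall j, z 0 j != 0.
Proof.
move=> uE t0 /h_orbit_eq[_ [xi _ H]] j.
have := H (dual_row E j); rewrite dual_row_mul// prod_delta => ->.
rewrite mulf_neq0//; apply/prodf_neq0 => k _; rewrite expfz_neq0//.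
by rewrite mxE cexp_neq0.
Qed.

Variables (r : nat) (L : 'M[R]_(n, r)).
Hypothesis hL : forall x, real_part h x -> x *m L = 0.

Lemma Im_mulL (xi : 'rV[C]_n) : xi \in h -> map_mx (@complex.Im R) xi *m L = 0.
Proof.
move=> hxi; apply: hL; exists (- 'i *: xi); first exact: memvZ.
by apply/rowP => k; rewrite !mxE; case: (xi 0 k) => p q /=; ring.
Qed.

(* Evaluate the characters dual to the basis [E] at both points. *)
Lemma orbit_log_invariant E E' z z' (s t : 'I_r) : E \in unitmx ->
  h_orbit h (toric_chart E z) = h_orbit h (toric_chart E' z') ->
  (forall j, z 0 j = 0 -> (lrow R E j *m L) 0 s = (lrow R E j *m L) 0 t) ->
  \sum_j ((lrow R E j *m L) 0 s - (lrow R E j *m L) 0 t) * lnsq (z 0 j) =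
  \sum_j ((lrow R E' j *m L) 0 s - (lrow R E' j *m L) 0 t) * lnsq (z' 0 j).
Proof.
move=> uE /h_orbit_eq[_ [xi hxi H]] z0.
pose c j := (lrow R E j *m L) 0 s - (lrow R E j *m L) 0 t.
pose u j := dual_row E j.
have Hj j : c j * lnsq (z 0 j) =
    c j * (4 * pi * \sum_(k < n) complex.Im (xi 0 k) * (u j 0 k)%:~R) +
    c j * \sum_(l < n) ((u j *m E'^T) 0 l)%:~R * lnsq (z' 0 l).
  (* At a zero of z_j there is no logarithm to compare, but the coefficient is zero. *)
  have [/z0 cj|zj] := eqVneq (z 0 j) 0; first by rewrite /c cj subrr !mul0r addr0.
  rewrite -mulrDr; congr (_ * _).
  have := H (u j); rewrite /u dual_row_mul// prod_delta => Hu.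
  have e0 : \prod_(k < n) torus_exp xi 0 k ^ u j 0 k != 0.
    by apply/prodf_neq0 => k _; rewrite expfz_neq0// mxE cexp_neq0.
  have p0 : \prod_(l < n) z' 0 l ^ (dual_row E j *m E'^T) 0 l != 0.
    by rewrite Hu mulf_neq0.
  have := congr1 (@lnsq R) Hu; rewrite lnsqM// lnsq_torus_exp lnsq_prod; last first.
    by move=> l; move/prodf_neq0: p0; apply.
  move/eqP; rewrite eq_sym addrC subr_eq addrC => /eqP ->; congr (_ + _).
  apply: eq_bigr => l _; apply: lnsq_expz => zl.
  by move/prodf_neq0: p0 => /(_ l isT); rewrite zl expfz_eq0 eqxx andbT negbK => /eqP.
pose Er := map_mx (intr : int -> R) E; pose U := map_mx (intr : int -> R) (invmx E).
pose E'r := map_mx (intr : int -> R) E'.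
have UE : U *m Er = 1%:M by rewrite -map_mxM mulVmx// map_mx1.
pose d : 'cV[R]_n := L *m (delta_mx s 0 - delta_mx t 0).
have cE (A : 'M[int]_n) j :
    (lrow R A j *m L) 0 s - (lrow R A j *m L) 0 t = (map_mx intr A *m d) j 0.
  by rewrite !lrow_mul /d mulmxA mulmxBr -!colE; move: (_ *m L) => B; rewrite !mxE.
have uE' j k : ((u j 0 k)%:~R : R) = U k j by rewrite !mxE.
rewrite (eq_bigr _ (fun j _ => Hj j)) big_split /= [X in X + _](_ : _ = 0) ?add0r.
  under eq_bigr => j _ do rewrite mulr_sumr.
  rewrite exchange_big /=; apply: eq_bigr => l _.
  have dE : E'r *m d = (E'r *m U) *m (Er *m d) by rewrite mulmxA -(mulmxA E'r) UE mulmx1.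
  rewrite cE -/E'r dE [in RHS]mxE mulr_suml.
  apply: eq_bigr => j _; rewrite /c cE -/Er mulrA; congr (_ * _).
  rewrite [RHS]mulrC; congr (_ * _).
  have -> : ((u j *m E'^T) 0 l)%:~R = map_mx (intr : int -> R) (u j *m E'^T) 0 l.
    by rewrite [RHS]mxE.
  by rewrite map_mxM !mxE; apply: eq_bigr => k _; rewrite !mxE mulrC.
(* Up to the factor 4 pi, the torus element contributes the value of the form s - t on the imaginary
   part of [xi], which lies in p(h). *)
transitivity (4 * pi * ((map_mx (@complex.Im R) xi *m d) 0 0)); last first.
  by rewrite /d mulmxA Im_mulL// mul0mx mxE mulr0.
have dE : map_mx (@complex.Im R) xi *m d =
    (map_mx (@complex.Im R) xi *m U) *m (Er *m d).
  by rewrite mulmxA -(mulmxA _ U) UE mulmx1.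
rewrite dE [in RHS]mxE mulr_sumr; apply: eq_bigr => j _.
rewrite /c cE -/Er mulrCA; congr (_ * _); rewrite [LHS]mulrC; congr (_ * _).
rewrite [RHS]mxE; apply: eq_bigr => k _; rewrite uE'; congr (_ * _).
by rewrite mxE.
Qed.

End Orbits.

(** * Invariance of the form under changes of charts *)

Section Monomials.
Variables (R : realType) (n r : nat).
Local Notation C := R[i].
Implicit Types (z : 'rV[C]_n).

Lemma mono_expR (a : 'I_r -> 'I_n -> R) z s : (forall j, z 0 j = 0 -> a s j = 0) ->
  mono a z s = expR (\sum_j a s j * lnsq (z 0 j)).
Proof.
move=> H; rewrite expR_sum; apply: eq_bigr => j _.
have [/H->|zj] := eqVneq (z 0 j) 0; first by rewrite rpow0 mul0r expR0.
by rewrite rpow_pos// sqn_gt0.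
Qed.

Lemma mono_neq0 (a : 'I_r -> 'I_n -> R) z s :
  mono a z s != 0 -> forall j, z 0 j = 0 -> a s j = 0.
Proof.
move/prodf_neq0 => H j zj; apply/eqP; apply: contraNT (H j isT) => aj.
by rewrite rpow_npos// zj /sqn /= expr0n addr0.
Qed.

(** If all monomials are multiplied by k, every [qform] is multiplied by k^2 and [sumsq] by k^2, so
    [kform] is unchanged. Differences of [dlog] count only where both monomials are nonzero, since
    otherwise [qform] is zero. *)
Lemma kform_eq (a a' : 'I_r -> 'I_n -> R) z z' X X' Y Y' :
  (forall s t, mono a' z' s * mono a z t = mono a z s * mono a' z' t) ->
  (forall s, mono a z s != 0 -> mono a' z' s != 0) ->
  (forall s t, mono a z s != 0 -> mono a z t != 0 ->
     dlog a' s z' X' - dlog a' t z' X' = dlog a s z X - dlog a t z X) ->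
  (forall s t, mono a z s != 0 -> mono a z t != 0 ->
     dlog a' s z' Y' - dlog a' t z' Y' = dlog a s z Y - dlog a t z Y) ->
  (exists s, mono a z s != 0) ->
  kform a z X Y = kform a' z' X' Y'.
Proof.
move=> cross nz dX dY [s0 s00].
have [k k0 ka] : exists2 k : R, k != 0 & forall s, mono a' z' s = k * mono a z s.
  exists (mono a' z' s0 / mono a z s0); first by rewrite mulf_neq0 ?invr_eq0// nz.
  by move=> s; apply: (mulIf s00); rewrite cross; field.
have S0 : sumsq a z != 0.
  rewrite /sumsq (bigD1 s0)//= gt_eqF// ltr_pwDl//.
    by rewrite exprn_even_gt0.
  by apply: sumr_ge0 => t _; exact: sqr_ge0.
have Sk : sumsq a' z' = k ^+ 2 * sumsq a z.
  by rewrite /sumsq mulr_sumr; apply: eq_bigr => s _; rewrite ka exprMn.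
have qk s t V V' : (mono a z s != 0 -> mono a z t != 0 ->
     dlog a' s z' V' - dlog a' t z' V' = dlog a s z V - dlog a t z V) ->
     qform a' s t z' V' = (k ^+ 2)%:C * qform a s t z V.
  move=> H; rewrite /qform !ka.
  have [->|s1] := eqVneq (mono a z s) 0; first by rewrite mulr0 !mul0r mulr0.
  have [->|t1] := eqVneq (mono a z t) 0; first by rewrite !mulr0 !mul0r mulr0.
  by rewrite H// expr2 !rmorphM; ring.
rewrite /kform Sk; move: (sumsq a z) S0 {Sk} => S S0.
rewrite !mulr_sumr; apply: eq_bigr => s _.
rewrite !mulr_sumr; apply: eq_bigr => t _.
rewrite (qk s t _ _ (dX s t)) (qk s t _ _ (dY s t)).
move: (qform a s t z X) (qform a s t z Y) => [p1 p2] [q1 q2] /=.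
by field; rewrite S0 k0.
Qed.

End Monomials.

Section ChartChange.
Variables (R : realType) (n r : nat) (h : {vspace 'rV[R[i]]_n}) (L : 'M[R]_(n, r)).
Local Notation C := R[i].
Hypothesis hL : forall x, real_part h x -> x *m L = 0.
Implicit Types (E : 'M[int]_n) (z : 'rV[C]_n) (s t : 'I_r).

Definition chart_weight E s j : R := excess L s (lrow R E j).

(** A linear inequality holds on a cone as soon as it holds on generators, and the rows at the
    vanishing coordinates generate the same cone in both charts. *)
Lemma zero_cone_linear_le E E' z z' s t :
  zero_cone E' z' = zero_cone E z :> set 'rV[R]_n ->
  (forall j, z 0 j = 0 -> (lrow R E j *m L) 0 s <= (lrow R E j *m L) 0 t) ->
  forall l, z' 0 l = 0 -> (lrow R E' l *m L) 0 s <= (lrow R E' l *m L) 0 t.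
Proof.
move=> HE H l zl.
have : zero_cone E z (lrow R E' l).
  by rewrite -HE; apply: lattice_cone_mem; rewrite inE zl.
move/(lattice_cone_ge0 (phi := fun x => (x *m L) 0 t - (x *m L) 0 s)).
rewrite subr_ge0; apply.
- by rewrite mul0mx !mxE subrr.
- by move=> c y y'; rewrite mulmxDl -scalemxAl !mxE; ring.
- by move=> j; rewrite inE subr_ge0 => /eqP /H.
Qed.

Lemma zero_cone_linear_eq E E' z z' s t :
  zero_cone E' z' = zero_cone E z :> set 'rV[R]_n ->
  (forall j, z 0 j = 0 -> (lrow R E j *m L) 0 s = (lrow R E j *m L) 0 t) ->
  forall l, z' 0 l = 0 -> (lrow R E' l *m L) 0 s = (lrow R E' l *m L) 0 t.
Proof.
move=> HE H l zl; apply/eqP; rewrite eq_le.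
by rewrite !(zero_cone_linear_le HE)// => j /H->.
Qed.

Lemma zero_cone_excess E E' z z' s :
  zero_cone E' z' = zero_cone E z :> set 'rV[R]_n ->
  (forall j, z 0 j = 0 -> chart_weight E s j = 0) ->
  forall l, z' 0 l = 0 -> chart_weight E' s l = 0.
Proof.
move=> HE H l zl; apply: excess_eq0 => t.
by apply: (zero_cone_linear_le HE) zl => j /H /excess0_le.
Qed.

(** The ratio of the monomials s and t does not depend on the chart. If one vanishes, it does so in
    both charts; otherwise both excesses are zero on the cone of the point, so the two forms agree
    there and [orbit_log_invariant] compares the logarithms. *)
Lemma mono_cross E E' z z' s t : E \in unitmx ->
  h_orbit h (toric_chart E z) = h_orbit h (toric_chart E' z') ->
  mono (chart_weight E') z' s * mono (chart_weight E) z t =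
  mono (chart_weight E) z s * mono (chart_weight E') z' t.
Proof.
move=> uE Ho; have [HE _] := h_orbit_eq Ho.
have P u : mono (chart_weight E) z u = 0 -> mono (chart_weight E') z' u = 0.
  move=> /eqP; apply: contraTeq => /mono_neq0 H.
  by rewrite (mono_expR (zero_cone_excess (esym HE) H)) gt_eqF// expR_gt0.
have [s0|s0] := eqVneq (mono (chart_weight E) z s) 0; first by rewrite s0 (P s s0) !mul0r.
have [t0|t0] := eqVneq (mono (chart_weight E) z t) 0; first by rewrite t0 (P t t0) !mulr0.
have Hs := mono_neq0 s0; have Ht := mono_neq0 t0.
rewrite (mono_expR Hs) (mono_expR Ht) (mono_expR (zero_cone_excess HE Hs)).
rewrite (mono_expR (zero_cone_excess HE Ht)) -!expRD; congr expR.
have K : forall j, z 0 j = 0 -> (lrow R E j *m L) 0 s = (lrow R E j *m L) 0 t.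
  move=> j zj; apply/eqP; rewrite -subr_eq0 -excessB.
  by have := Hs j zj; have := Ht j zj; rewrite /chart_weight => -> ->; rewrite subrr.
have := orbit_log_invariant hL uE Ho K.
under eq_bigr => j _ do rewrite -excessB mulrBl.
under [in X in _ = X -> _]eq_bigr => j _ do rewrite -excessB mulrBl.
by rewrite !sumrB /chart_weight => ?; lra.
Qed.

Lemma dlogB E z X s t : dlog (chart_weight E) s z X - dlog (chart_weight E) t z X =
  \sum_j ((lrow R E j *m L) 0 s - (lrow R E j *m L) 0 t)%:C * (X 0 j / z 0 j).
Proof.
rewrite /dlog -sumrB; apply: eq_bigr => j _.
by rewrite -excessB rmorphB mulrBl.
Qed.

End ChartChange.

Section LogDerivative.
Variables (R : realType) (m n : nat).
Local Notation C := R[i].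
Local Notation E := 'rV[C]_m.

Lemma is_rderive_sum_lnsq (F : E -> 'rV[C]_n) (c : 'I_n -> R) x v :
  differentiable F x -> (forall j, F x 0 j = 0 -> c j = 0) ->
  is_rderive v (fun y => \sum_j c j * lnsq (F y 0 j)) x
    (2 * complex.Re (\sum_j (c j)%:C * ('d F x v 0 j / F x 0 j))).
Proof.
move=> dF c0; rewrite raddf_sum mulr_sumr; apply: is_rderive_sum => j.
have [/c0->|Fj] := eqVneq (F x 0 j) 0.
  under eq_fun => y do rewrite mul0r.
  by rewrite mul0r mulr0; exact: is_rderive_cst.
have s0 : 0 < sqn (F x 0 j) by rewrite sqn_gt0.
have Hre := is_derive_line_Re v j dF; have Him := is_derive_line_Im v j dF.
have Hs : is_rderive v (fun y => sqn (F y 0 j)) x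
    (2 * (complex.Re ('d F x v 0 j) * complex.Re (F x 0 j)
      + complex.Im ('d F x v 0 j) * complex.Im (F x 0 j))).
  rewrite /sqn; under eq_fun => y do rewrite !expr2.
  apply: is_rderive_eq (is_rderiveD (is_rderiveM Hre Hre) (is_rderiveM Him Him)) _.
  ring.
have Hl := is_rderive_comp (is_derive1_ln s0) Hs.
apply: is_rderive_eq (is_rderiveM (is_rderive_cst v x (c j)) Hl) _.
rewrite /= cReZ cRe_div; ring.
Qed.

End LogDerivative.

(** * The form on the quotient *)

Section KahlerTensor.
Variables (R : realType) (n r : nat) (Sigma : set (set 'rV[R]_n)).
Variables (h : {vspace 'rV[R[i]]_n}) (L : 'M[R]_(n, r)).
Local Notation C := R[i].
Local Notation m := (n - \dim h)%N.
Local Notation E := 'rV[C]_m.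
Hypothesis hL : forall x, real_part h x -> x *m L = 0.
Hypothesis hmin : forall B I, B \in unitmx -> Sigma (lattice_cone B I) ->
  exists s : 'I_r, forall j, j \in I -> excess L s (lrow R B j) = 0.

Definition kahler_tensor : two_tensor (quotient_manifold Sigma h) :=
  fun c x X Y => kform (chart_weight L (slice_basis c)) (slice_map c x)
    ('d (slice_map c) x X) ('d (slice_map c) x Y).

Implicit Types (c : slice Sigma h) (x X Y v : E).

Lemma slice_mono_neq0 c x : slice_dom c x ->
  exists s, mono (chart_weight L (slice_basis c)) (slice_map c x) s != 0.
Proof.
move=> cx; have [s Hs] := hmin (slice_unit c) (slice_in cx).
exists s; rewrite mono_expR ?gt_eqF ?expR_gt0// => j zj.
by apply: Hs; rewrite inE zj.
Qed.

Lemma slice_sumsq_gt0 c x : slice_dom c x ->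
  0 < sumsq (chart_weight L (slice_basis c)) (slice_map c x).
Proof.
move=> /slice_mono_neq0[s s0].
rewrite /sumsq (bigD1 s)//= ltr_pwDl ?exprn_even_gt0//.
by apply: sumr_ge0 => t _; exact: sqr_ge0.
Qed.

(* Differentiating [orbit_log_invariant] along real lines gives the real parts;
   the imaginary parts follow by applying them to [- i X]. *)
Lemma transition_log_derivative c c' x (f : E -> E) (s t : 'I_r) :
  slice_dom c x -> transition (M := quotient_manifold Sigma h) c c' x f ->
  (forall j, slice_map c x 0 j = 0 ->
     (lrow R (slice_basis c) j *m L) 0 s = (lrow R (slice_basis c) j *m L) 0 t) ->
  forall X,
  \sum_j ((lrow R (slice_basis c') j *m L) 0 s - (lrow R (slice_basis c') j *m L) 0 t)%:C
     * ('d (slice_map c') (f x) ('d f x X) 0 j / slice_map c' (f x) 0 j) =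
  \sum_j ((lrow R (slice_basis c) j *m L) 0 s - (lrow R (slice_basis c) j *m L) 0 t)%:C
     * ('d (slice_map c) x X 0 j / slice_map c x 0 j).
Proof.
move=> cx [D [Do Dx [df _] Hpar]] z0.
have [c'x /esym Hx] := Hpar x Dx.
have [dsc Csc] := slice_holo c; have [dsc' _] := slice_holo c'.
pose F := slice_map c' \o f.
have dF : differentiable F x.
  by apply: differentiable_comp; [exact: df|exact: dsc'].
have dFE X : 'd F x X = 'd (slice_map c') (f x) ('d f x X).
  exact: (congr1 (fun g : E -> 'rV[C]_n => g X) (diff_comp (df x Dx) (dsc' _ c'x))).
pose d B j := (lrow R B j *m L) 0 s - (lrow R B j *m L) 0 t.
have Hd j : slice_map c x 0 j = 0 -> d (slice_basis c) j = 0.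
  by move=> /z0; rewrite /d => ->; rewrite subrr.
have Hd' j : F x 0 j = 0 -> d (slice_basis c') j = 0.
  have [HE _] := h_orbit_eq Hx.
  by move=> /(zero_cone_linear_eq HE z0); rewrite /d => ->; rewrite subrr.
have ReE X : complex.Re (\sum_j (d (slice_basis c') j)%:C * ('d F x X 0 j / F x 0 j)) =
    complex.Re (\sum_j (d (slice_basis c) j)%:C *
       ('d (slice_map c) x X 0 j / slice_map c x 0 j)).
  have H1 := is_rderive_sum_lnsq X dF Hd'.
  have H2 := is_rderive_sum_lnsq X (dsc x cx) Hd.
  (* No coordinate acquires a new zero on [N], so the vanishing condition of [orbit_log_invariant],
     known at [x], holds at every point of [N]. *)
  pose N := D `&` slice_dom c `&`
    interior [set y | forall j, slice_map c x 0 j != 0 -> slice_map c y 0 j != 0].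
  have No : open N.
    by apply: openI; [apply: openI => //; exact: slice_open|exact: open_interior].
  have Nx : N x.
    split => //.
    have nb j : nbhs x (fun y => slice_map c x 0 j != 0 -> slice_map c y 0 j != 0).
      have [fx0|fx0] := eqVneq (slice_map c x 0 j) 0; first by apply: filterS filterT => y.
      have H := near_neq0 (@slice_open _ _ _ _ c) (holomorphic_CkC (slice_holo c) 0 j) cx fx0.
      by apply: filterS H => y.
    exact: filter_forall nb.
  have G y : N y -> \sum_j d (slice_basis c) j * lnsq (slice_map c y 0 j) =
      \sum_j d (slice_basis c') j * lnsq (F y 0 j).
    move=> [[Dy cy] /interior_subset Ny].
    have [_ /esym Hy] := Hpar y Dy.
    apply: (orbit_log_invariant hL (slice_unit c) Hy) => j yj; apply: z0.
    by apply/eqP; apply/negPn/negP => /Ny; rewrite yj eqxx.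
  have H3 := is_rderive_ext No Nx G H2.
  have [_ E1] := is_rderiveW H1; have [_ E3] := is_rderiveW H3.
  by apply: (mulfI (x := 2 : R)); rewrite ?pnatr_eq0// -E1 -E3.
move=> X.
under [LHS]eq_bigr => j _ do rewrite -dFE.
have lin (k : nat) (c0 : 'I_k -> R) (z : 'I_k -> C) (l : {linear E -> 'rV[C]_k}) :
   complex.Re (\sum_j (c0 j)%:C * (l (- 'i *: X) 0 j / z j)) =
   complex.Im (\sum_j (c0 j)%:C * (l X 0 j / z j)).
  have -> : \sum_j (c0 j)%:C * (l (- 'i *: X) 0 j / z j) =
      - 'i * \sum_j (c0 j)%:C * (l X 0 j / z j).
    rewrite mulr_sumr; apply: eq_bigr => j _; rewrite linearZ mxE; ring.
  by case: (\sum_j _) => p q /=; ring.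
apply/eqP; rewrite eq_complex; apply/andP; split; apply/eqP; first exact: ReE.
have := ReE (- 'i *: X).
rewrite (lin _ (d (slice_basis c'))  (fun j => F x 0 j)).
by rewrite (lin _ (d (slice_basis c))  (fun j => slice_map c x 0 j)).
Qed.

Lemma kahler_tensor_two_form : two_form kahler_tensor.
Proof.
split.
- by move=> c x X X' Y a cx; rewrite /kahler_tensor linearP kform_linearl.
- by move=> c x X Y cx; exact: kform_alternating.
move=> c c' x f X Y cx ft; rewrite /kahler_tensor.
have [D [Do Dx _ /(_ x Dx)[c'x /esym Hx]]] := ft.
(* Two nonzero monomials have zero excess on the cone of the point, hence their forms agree on
   it. *)
have K s t : mono (chart_weight L (slice_basis c)) (slice_map c x) s != 0 ->
    mono (chart_weight L (slice_basis c)) (slice_map c x) t != 0 ->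
    forall j, slice_map c x 0 j = 0 ->
     (lrow R (slice_basis c) j *m L) 0 s = (lrow R (slice_basis c) j *m L) 0 t.
  move=> /mono_neq0 Hs /mono_neq0 Ht j zj; apply/eqP; rewrite -subr_eq0 -excessB.
  by have := Hs j zj; have := Ht j zj; rewrite /chart_weight => -> ->; rewrite subrr.
have [HE _] := h_orbit_eq Hx.
apply: kform_eq.
- move=> s t; exact: (mono_cross hL _ _ (slice_unit c) Hx).
- move=> s /mono_neq0 Hs.
  by rewrite (mono_expR (zero_cone_excess HE Hs)) gt_eqF// expR_gt0.
- move=> s t s0 t0; rewrite !dlogB; exact: transition_log_derivative (K s t s0 t0) X.
- move=> s t s0 t0; rewrite !dlogB; exact: transition_log_derivative (K s t s0 t0) Y.
- exact: slice_mono_neq0.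
Qed.

Lemma kahler_tensor_type11 : type11 kahler_tensor.
Proof. by move=> c x cx; exact: kform_type11. Qed.

Lemma kahler_tensor_Ck k :
  (forall B I, B \in unitmx -> Sigma (lattice_cone B I) ->
     forall j s, j \in I -> excess L s (lrow R B j) = 0 \/
        k.+1%:R < excess L s (lrow R B j)) ->
  Ck_form k kahler_tensor.
Proof.
move=> hbig c X Y; apply: Ck_kform.
- exact: slice_open.
- exact: slice_holo.
- by move=> x; exact: slice_sumsq_gt0.
- move=> x j cx zj s; apply: (hbig _ _ (slice_unit c) (slice_in cx)).
  by rewrite inE zj.
Qed.

Lemma holomorphic_sub (p : nat) (D D' : set E) (f : E -> 'rV[C]_p) :
  D' `<=` D -> holomorphic D f -> holomorphic D' f.
Proof.
move=> DD [df Cf]; split; first by move=> x /DD /df.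
by move=> k j; have [C1 C2] := Cf k j; split; apply: Ck_sub DD _.
Qed.

Lemma kahler_tensor_closed c x : slice_dom c x ->
  (forall j, slice_map c x 0 j != 0) -> closed_form_at kahler_tensor c x.
Proof.
move=> cx z0.
pose N := slice_dom c `&` interior [set y | forall j, slice_map c y 0 j != 0].
have No : open N by apply: openI; [exact: slice_open|exact: open_interior].
apply: (@kform_closed _ _ _ _ _ N); [exact: No|..].
- by apply: holomorphic_sub (slice_holo c) => y [].
- by move=> y j [_ /interior_subset]; apply.
split => //.
have nb j : nbhs x (fun y => slice_map c y 0 j != 0).
  exact: near_neq0 (@slice_open _ _ _ _ c) (holomorphic_CkC (slice_holo c) 0 j) cx (z0 j).
exact: filter_forall nb.
Qed.

End KahlerTensor.

(** * The kernel of the form on the open orbit *)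

Section Kernel.
Variables (R : realType) (n r : nat) (h : {vspace 'rV[R[i]]_n}) (L : 'M[R]_(n, r)).
Local Notation C := R[i].
Hypothesis hL : forall x, real_part h x -> x *m L = 0.
Hypothesis hker : forall x : 'rV[R]_n,
  (forall s t, (x *m L) 0 s = (x *m L) 0 t) -> real_part h x.

(** Where no coordinate vanishes, all monomials are positive, so the sum of squares in [kform_J] is
    zero only if every difference of [dlog] is. *)
Lemma kform_J_eq0 (a : 'I_r -> 'I_n -> R) (z V : 'rV[C]_n) :
  (forall j, z 0 j != 0) ->
  kform a z V ('i *: V) = 0 <-> forall s t, dlog a s z V = dlog a t z V.
Proof.
move=> z0.
have m0 s : mono a z s != 0.
  rewrite mono_expR ?gt_eqF ?expR_gt0// => j zj.
  by have := z0 j; rewrite zj eqxx.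
rewrite kform_J; split=> [H s t|H]; last first.
  rewrite big1 ?mulr0// => s _; rewrite big1// => t _.
  by rewrite /qform (H s t) subrr mulr0 /sqn /= expr0n addr0.
have S0 : sumsq a z ^+ 2 != 0.
  rewrite expf_neq0// /sumsq (bigD1 s)//= gt_eqF// ltr_pwDl ?exprn_even_gt0 ?m0//.
  by apply: sumr_ge0 => u _; exact: sqr_ge0.
move/eqP: H; rewrite mulf_eq0 invr_eq0 (negPf S0) /= => /eqP H.
have H1 : \sum_(t < r) sqn (qform a s t z V) = 0.
  apply: (psumr_eq0P _ H) => // u _; apply: sumr_ge0 => v _; exact: sqn_ge0.
have H2 : sqn (qform a s t z V) = 0.
  by apply: (psumr_eq0P _ H1) => // u _; exact: sqn_ge0.
move/eqP: H2; rewrite sqn_eq0 /qform mulf_eq0.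
rewrite (fmorph_eq0 (real_complex R)) mulf_eq0 (negPf (m0 s)) (negPf (m0 t)) /=.
by rewrite subr_eq0 => /eqP.
Qed.

Local Notation Lc := (map_mx (real_complex R) L).

Lemma Re_mulL (xi : 'rV[C]_n) s :
  complex.Re ((xi *m Lc) 0 s) = (map_mx (@complex.Re R) xi *m L) 0 s.
Proof.
rewrite !mxE raddf_sum; apply: eq_bigr => k _.
by rewrite /= !mxE mulrC cReZ mulrC.
Qed.

Lemma Im_mulLc (xi : 'rV[C]_n) s :
  complex.Im ((xi *m Lc) 0 s) = (map_mx (@complex.Im R) xi *m L) 0 s.
Proof.
rewrite !mxE raddf_sum; apply: eq_bigr => k _.
by rewrite /= !mxE mulrC cImZ mulrC.
Qed.

Lemma mem_mulLc (xi : 'rV[C]_n) : xi \in h -> xi *m Lc = 0.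
Proof.
move=> hxi; apply/rowP => s; apply/eqP; rewrite eq_complex; apply/andP.
rewrite Re_mulL Im_mulLc hL ?(Im_mulL hL hxi) ?mxE //.
by exists xi.
Qed.

Lemma conj_mulLc (xi : 'rV[C]_n) : xi \in h -> map_mx (@conjc R) xi *m Lc = 0.
Proof.
move=> hxi; apply/rowP => s; have H := mem_mulLc hxi.
have -> : (map_mx (@conjc R) xi *m Lc) 0 s = ((xi *m Lc) 0 s)^*.
  rewrite !mxE rmorph_sum; apply: eq_bigr => k _; rewrite !mxE.
  by case: (xi 0 k) => p q; apply/eqP; rewrite eq_complex /=; apply/andP; split; apply/eqP; ring.
by rewrite H !mxE (rmorph0 (@conjc R)).
Qed.

Lemma intr_mx_unit (E : 'M[int]_n) : E \in unitmx -> map_mx (intr : int -> C) E \in unitmx.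
Proof.
move=> uE; have : map_mx (intr : int -> C) E *m map_mx (intr : int -> C) (invmx E) = 1%:M.
  by rewrite -map_mxM mulmxV// map_mx1.
by case/mulmx1_unit.
Qed.

Lemma kform_kernel (E : 'M[int]_n) (z V : 'rV[C]_n) : E \in unitmx ->
  (forall j, z 0 j != 0) ->
  kform (chart_weight L E) z V ('i *: V) = 0 <->
  exists eta zeta, [/\ eta \in h, zeta \in h &
    V = fund_field E (map_mx (@conjc R) eta) z + fund_field E zeta z].
Proof.
move=> uE z0; have uEc := intr_mx_unit uE.
set Ec := map_mx (intr : int -> C) E in uEc.
have pi0 : (2 * pi)%:C * 'i != 0 :> C.
  rewrite mulf_neq0//; last by rewrite eq_complex /= negb_and oner_eq0 orbT.
  by rewrite (fmorph_eq0 (real_complex R)) mulf_neq0 ?pnatr_eq0// gt_eqF ?pi_gt0.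
have fundE e j : fund_field E e z 0 j = (2 * pi)%:C * 'i * (e *m invmx Ec) 0 j * z 0 j.
  by rewrite [LHS]mxE.
(* Up to the factor 2 pi i, [xi] is the element of t_C whose fundamental field has the value [V] at
   [z]. *)
pose xi := (\row_j (V 0 j / z 0 j)) *m Ec.
have dE s t : dlog (chart_weight L E) s z V - dlog (chart_weight L E) t z V =
    (xi *m Lc) 0 s - (xi *m Lc) 0 t.
  rewrite dlogB /xi -mulmxA [in RHS]mxE [X in _ - X]mxE -sumrB.
  apply: eq_bigr => j _; rewrite mxE -mulrBr mulrC; congr (_ * _).
  rewrite !lrow_mul rmorphB; congr (_ - _); rewrite !mxE rmorph_sum;
    by apply: eq_bigr => k _; rewrite /= rmorphM /= !mxE rmorph_int.
rewrite kform_J_eq0//; split=> [H|[eta [zeta [he hz HV]]] s t]; last first.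
  apply/eqP; rewrite -subr_eq0 dE.
  have -> : xi = ((2 * pi)%:C * 'i) *: (map_mx (@conjc R) eta + zeta).
    rewrite /xi HV (_ : \row_j _ = ((2 * pi)%:C * 'i) *:
       ((map_mx (@conjc R) eta + zeta) *m invmx Ec)).
      by rewrite -scalemxAl mulmxKV.
    apply/rowP => j; rewrite mulmxDl [LHS]mxE [X in X / _]mxE !fundE.
    move: (map_mx _ eta *m _) (zeta *m _) => A B; rewrite !mxE.
    by rewrite -mulrDl mulfK// -mulrDr.
  by rewrite -scalemxAl mulmxDl (mem_mulLc hz) (conj_mulLc he) addr0 scaler0 !mxE subrr.
have HL s t : (xi *m Lc) 0 s = (xi *m Lc) 0 t.
  by apply/eqP; rewrite -subr_eq0 -dE (H s t) subrr.
have [al hal Hal] : real_part h (map_mx (@complex.Re R) xi).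
  by apply: hker => s t; rewrite -!Re_mulL (HL s t).
have [ga hga Hga] : real_part h (map_mx (@complex.Im R) xi).
  by apply: hker => s t; rewrite -!Im_mulLc (HL s t).
pose q : C := ((2 * pi)%:C * 'i)^-1.
(* As [al] and [ga] have real parts Re xi and Im xi, xi is half of (al + i ga) + conj (al - i ga).
   Dividing by 2 pi i is multiplying by [q], which is purely imaginary: hence the sign in [eta]. *)
pose zeta := (q * (2^-1)%:C) *: (al + 'i *: ga).
pose eta := (- (q * (2^-1)%:C)) *: (al - 'i *: ga).
have hzeta : zeta \in h by rewrite memvZ// memvD// memvZ.
have heta : eta \in h by rewrite memvZ// memvB// memvZ.
exists eta, zeta; split; [exact: heta|exact: hzeta|].
have qc : q^* = - q.
  rewrite /q; move: pi0; have -> : (2 * pi)%:C * 'i = 0 +i* (2 * pi) :> C.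
    by apply/eqP; rewrite eq_complex /=; apply/andP; split; apply/eqP; ring.
  move=> p0; rewrite fmorphV -invrN; congr (_^-1).
  by apply/eqP; rewrite eq_complex /=; apply/andP; split; apply/eqP; ring.
have xiE (y : 'rV[C]_n) : map_mx (@complex.Re R) al = map_mx (@complex.Re R) y ->
    map_mx (@complex.Re R) ga = map_mx (@complex.Im R) y ->
    map_mx (@conjc R) eta + zeta = q *: y.
  move=> /rowP aly /rowP gay; apply/rowP => j.
  have := aly j; have := gay j; rewrite /eta /zeta !mxE.
  move: (al 0 j) (ga 0 j) (y 0 j) (q) qc => [a1 a2] [g1 g2] [y1 y2] [q1 q2].
  move=> /eqP; rewrite eq_complex => /andP[/= /eqP q0 _] -> ->.
  have -> : q1 = 0 by lra.
  by apply/eqP; rewrite eq_complex /=; apply/andP; split; apply/eqP; field.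
apply/rowP => j; rewrite [RHS]mxE !fundE -mulrDl -mulrDr.
have -> : (map_mx (@conjc R) eta *m invmx Ec) 0 j + (zeta *m invmx Ec) 0 j =
    q * (V 0 j / z 0 j).
  transitivity (((map_mx (@conjc R) eta + zeta) *m invmx Ec) 0 j).
    by rewrite mulmxDl [RHS]mxE.
  by rewrite (xiE xi Hal Hga) /xi -scalemxAl mulmxK// mxE mxE.
by rewrite /q mulVKf// divfK.
Qed.

End Kernel.

(** * Cones and fans *)

Section ConeClosure.
Variables (R : realType) (W : vectType R).
Implicit Types (g : seq W).

Lemma cone0 g : cone g 0.
Proof.
exists (fun=> 0); split; first by [].
by rewrite big1// => i _; rewrite scale0r.
Qed.

Lemma cone_scale_add g (c : R) x y : 0 <= c -> cone g x -> cone g y -> cone g (c *: x + y).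
Proof.
move=> c0 [a [a0 ->]] [b [b0 ->]]; exists (fun i => c * a i + b i); split.
  by move=> i; rewrite addr_ge0// mulr_ge0.
rewrite scaler_sumr -big_split; apply: eq_bigr => i _ /=.
by rewrite scalerDl scalerA.
Qed.

Lemma cone1E (w x : W) : cone [:: w] x <-> exists2 c : R, 0 <= c & x = c *: w.
Proof.
split=> [[c [c0 ->]]|[c c0 ->]].
  by exists (c ord0); rewrite ?c0// big_ord1.
by rewrite -[_ *: w]addr0; apply: cone_scale_add => //;
  [apply: cone_mem; rewrite inE|exact: cone0].
Qed.

Lemma lin_dim_cone g : lin_dim (cone g) (\dim <<g>>%VS).
Proof.
exists <<g>>%VS; split => //.
  move=> x [c [_ ->]]; apply: memv_suml => i _; apply: memvZ.
  by apply: memv_span; exact: mem_nth.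
move=> U' H; apply/span_subvP => x xg; apply: H; exact: cone_mem.
Qed.

Lemma lin_dim_uniq (A : set W) d e : lin_dim A d -> lin_dim A e -> d = e.
Proof.
move=> [U [AU minU <-]] [V [AV minV <-]]; apply/eqP; rewrite eqn_leq.
by rewrite !dimvS// ?minU ?minV.
Qed.

End ConeClosure.

Section LatticeCone.
Variables (R : realType) (n : nat).
Implicit Types (E : 'M[int]_n) (I : {set 'I_n}) (x : 'rV[R]_n).

Definition lcoord E x : 'rV[R]_n := x *m map_mx intr (invmx E).

Lemma lcoordK E x : E \in unitmx -> lcoord E x *m map_mx intr E = x.
Proof. by move=> uE; rewrite /lcoord -mulmxA -map_mxM mulVmx// map_mx1 mulmx1. Qed.

Lemma lcoord_lrow E B j : lcoord E (lrow R B j) = map_mx intr (row j B *m invmx E).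
Proof. by rewrite /lcoord /lrow -map_mxM. Qed.

Lemma lcoord_lrow_id E i : E \in unitmx -> lcoord E (lrow R E i) = delta_mx 0 i.
Proof. by move=> uE; rewrite lcoord_lrow -row_mul mulmxV// row1 map_delta_mx. Qed.

Lemma lcoordE E x : E \in unitmx -> x = \sum_j lcoord E x 0 j *: lrow R E j.
Proof.
move=> uE; rewrite -[LHS](lcoordK x uE) mulmx_sum_row.
by apply: eq_bigr => j _; rewrite /lrow map_row.
Qed.

Lemma lcoordP E c x y : lcoord E (c *: x + y) = c *: lcoord E x + lcoord E y.
Proof. by rewrite /lcoord mulmxDl -scalemxAl. Qed.

Lemma lattice_coneP E I x : E \in unitmx ->
  lattice_cone E I x <-> forall j, 0 <= lcoord E x 0 j /\ (j \notin I -> lcoord E x 0 j = 0).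
Proof.
move=> uE; split=> [Hx j|H].
  (* Taken with [e = 1] for the sign of a coordinate, and also with [e = -1] for its vanishing off
     [I]. *)
  have P (e : R) : (forall i, i \in I -> 0 <= e * lcoord E (lrow R E i) 0 j) ->
      0 <= e * lcoord E x 0 j.
    move=> He; apply: (lattice_cone_ge0 (phi := fun x => e * lcoord E x 0 j) _ _ He Hx).
      by rewrite /lcoord mul0mx mxE mulr0.
    by move=> c y z; rewrite lcoordP !mxE; ring.
  split; first by rewrite -[X in _ <= X]mul1r; apply: P => i _;
    rewrite lcoord_lrow_id// mul1r mxE ler0n.
  move=> jI; apply/eqP; rewrite eq_le -oppr_ge0 -mulN1r P/= => [|i iI].
    rewrite -[X in _ <= X]mul1r P// => i _.
    by rewrite lcoord_lrow_id// mul1r mxE ler0n.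
  rewrite lcoord_lrow_id// mxE eqxx; case: eqP => [ji|]; last by rewrite mulr0.
  by move: jI; rewrite ji iI.
rewrite (lcoordE x uE); elim/big_rec : _ => [|j y _ Hy]; first exact: cone0.
have [Hj Hj'] := H j; have [jI|/Hj'->] := boolP (j \in I).
  by apply: cone_scale_add => //; exact: lattice_cone_mem.
by rewrite scale0r add0r.
Qed.

(** The supporting form is the sum of all coordinates other than the j-th. *)
Lemma face_lattice_ray E I j : E \in unitmx -> j \in I ->
  face (lattice_cone E [set j] : set 'rV[R]_n) (lattice_cone E I).
Proof.
move=> uE jI.
pose phi (x : 'rV[R]_n) : R^o := \sum_(i | i != j) lcoord E x 0 i.
have phi_lin : linear phi.
  move=> c x y; rewrite /phi scaler_sumr -big_split; apply: eq_bigr => i _ /=.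
  by rewrite lcoordP !mxE.
pose phiL := GRing.isLinear.Build R 'rV[R]_n R^o _ phi phi_lin.
pose phi' : {linear 'rV[R]_n -> R^o} := HB.pack phi phiL.
have lE x : linfun phi' x = phi x := lfunE phi' x.
exists (linfun phi'); split.
  move=> x /(lattice_coneP _ _ uE) Hx; rewrite lfunE /=.
  by apply: sumr_ge0 => i _; have [] := Hx i.
rewrite eqEsubset; split=> x /=.
  move=> /(lattice_coneP _ _ uE) Hx; split.
    apply/(lattice_coneP _ _ uE) => i; have [H1 H2] := Hx i; split => // iI.
    by apply: H2; rewrite inE; apply: contraNneq iI => ->.
  apply: etrans (lE x) _; rewrite /phi big1// => i ij; have [_ ->//] := Hx i.
  by rewrite inE.
move=> [/(lattice_coneP _ _ uE) Hx] /(etrans (esym (lE x))) H0.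
apply/(lattice_coneP _ _ uE) => i; have [H1 H2] := Hx i; split => //.
rewrite inE => ij; apply: (psumr_eq0P _ H0) => // k _; by have [] := Hx k.
Qed.

End LatticeCone.

(** * Cones of maximal dimension near a point *)

Section Avoidance.
Variables (R : realType) (W : vectType R).

Lemma eventually_seq (T : eqType) (s : seq T) (P : T -> nat -> Prop) :
  (forall U, U \in s -> exists K, forall k, (K <= k)%N -> P U k) ->
  exists K, forall k, (K <= k)%N -> forall U, U \in s -> P U k.
Proof.
elim: s => [|U s IH] H; first by exists 0%N.
have [|K1 HK1] := IH; first by move=> V Vs; apply: H; rewrite inE Vs orbT.
have [K2 HK2] := H U (mem_head _ _).
exists (maxn K1 K2) => k; rewrite geq_max => /andP[k1 k2] V.
by rewrite inE => /orP[/eqP->|]; [exact: HK2|exact: HK1].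
Qed.

(* A line whose direction is not in [U] meets [U] at most once. *)
Lemma eventually_notin (U : {vspace W}) (y v : W) (e : nat -> R) :
  injective e -> v \notin U ->
  exists K, forall k, (K <= k)%N -> y + e k *: v \notin U.
Proof.
move=> inje vU.
have [[k0 Hk0]|H] := pselect (exists k0, y + e k0 *: v \in U); last first.
  by exists 0%N => k _; apply/negP => Hk; apply: H; exists k.
exists k0.+1 => k kk0; apply: contra vU => Hk.
have ek : e k - e k0 != 0.
  by rewrite subr_eq0; apply/eqP => /inje kE; rewrite kE ltnn in kk0.
have := memvB Hk Hk0; rewrite opprD addrACA subrr add0r -scalerBl => H.
by rewrite -[v](scalerK ek) memvZ.
Qed.

(** If the vector [v] avoiding the other subspaces lies in [U], start from a point [w] outside [U]
    and move along [v]: this never enters [U] and eventually leaves each of the others. *)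
Lemma avoid_subspaces (s : seq {vspace W}) :
  (forall U, U \in s -> U != fullv) -> exists v, forall U, U \in s -> v \notin U.
Proof.
elim: s => [|U s IH] H; first by exists 0.
have [|v Hv] := IH; first by move=> V Vs; apply: H; rewrite inE Vs orbT.
have [vU|vU] := boolP (v \in U); last first.
  by exists v => V; rewrite inE => /orP[/eqP->|/Hv].
have [w wU] : exists w, w \notin U.
  apply: contrapT => H'; move/negP: (H U (mem_head _ _)); apply.
  rewrite eqEsubv subvf /=; apply/subvP => w _; apply/negPn/negP => wU.
  by apply: H'; exists w.
have inj : injective (fun k : nat => k%:R : R).
  by move=> k l /eqP; rewrite eqr_nat => /eqP.
have [K HK] := @eventually_seq _ s (fun V k => w + k%:R *: v \notin V)
  (fun V Vs => eventually_notin w inj (Hv V Vs)).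
exists (w + K%:R *: v) => V; rewrite inE => /orP[/eqP->|]; last exact: HK.
apply: contra wU => H'; rewrite -[w](addrK (K%:R *: v)).
by rewrite memvB// memvZ.
Qed.

End Avoidance.

Section Perturbation.
Variables (R : realType) (W : vectType R) (SS : set (set W)).

(* Perturbing [y] in a direction [v] outside the spans of the other cones. *)
Lemma max_cone_near (y : W) : finite_set SS ->
  (forall s, SS s -> polyhedral_cone s) -> complete_fan SS ->
  exists v s, max_cone SS s /\
    forall K, exists2 k, (K <= k)%N & s (y + (k.+1%:R : R)^-1 *: v).
Proof.
move=> /finite_seqP[ss SSE] poly compl.
have HG s : exists g : seq W, SS s -> s = cone g.
  have [/poly[g Hg]|Hs] := pselect (SS s); first by exists g.
  by exists [::].
have {HG} [G HG] := choice HG.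
pose bad := [seq <<G s>>%VS | s <- ss & ~~ `[< max_cone SS s >]].
have [v Hv] : exists v : W, forall U, U \in bad -> v \notin U.
  apply: avoid_subspaces => U /mapP[s]; rewrite mem_filter => /andP[/asboolPn Hs sss ->].
  have SSs : SS s by rewrite SSE.
  (* A cone that spans the whole space has maximal dimension, so the spans to be avoided are
     proper. *)
  have ds : lin_dim s (\dim <<G s>>) by rewrite {1}(HG s SSs); exact: lin_dim_cone.
  apply/eqP => Gs; apply: Hs; split => //; exists (\dim <<G s>>); split => // t e SSt te.
  have dt : lin_dim t (\dim <<G t>>) by rewrite {1}(HG t SSt); exact: lin_dim_cone.
  by rewrite (lin_dim_uniq te dt) Gs dimvS// subvf.
exists v; apply: contrapT => H.
have inje : injective (fun k : nat => (k.+1%:R : R)^-1).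
  by move=> k l /invr_inj/eqP; rewrite eqr_nat => /eqP[].
have Hev s : s \in ss -> exists K, forall k, (K <= k)%N -> ~ s (y + (k.+1%:R : R)^-1 *: v).
  move=> sss; have SSs : SS s by rewrite SSE.
  have [ms|ms] := pselect (max_cone SS s).
    apply: contrapT => H'; apply: H; exists s; split => // K.
    apply: contrapT => H''; apply: H'; exists K => k Kk sk.
    by apply: H''; exists k.
  have vs : v \notin <<G s>>%VS.
    apply: Hv; apply/mapP; exists s => //; rewrite mem_filter sss andbT.
    exact/asboolPn.
  have [K HK] := eventually_notin y inje vs.
  exists K => k /HK/negP Hk Hc; apply: Hk; move: Hc.
  rewrite {1}(HG s SSs) => -[c [_ ->]]; apply: memv_suml => i _; apply: memvZ.
  by apply: memv_span; exact: mem_nth.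
have [K HK] := eventually_seq Hev.
have [s SSs Hs] : (\bigcup_(s in SS) s) (y + (K.+1%:R : R)^-1 *: v).
  by have -> : \bigcup_(s in SS) s = setT by [].
by apply: (HK K (leqnn K) s) Hs; rewrite SSE in SSs.
Qed.

End Perturbation.

(** * Maximal cones and vertices of the image fan *)

Section FanData.
Variables (R : realType) (n : nat) (Sigma : set (set 'rV[R]_n)).
Variables (W : vectType R) (q : 'Hom('rV[R]_n, W)).
Local Notation SS := [set q @` s | s in Sigma].
Hypothesis Sfan : regular_fan Sigma.
Hypothesis Wfan : is_fan SS.
Hypothesis Wcomplete : complete_fan SS.
Hypothesis qbij : set_bij (\bigcup_(s in Sigma) s) setT q.

Lemma q_inj s x y : Sigma s -> s x -> s y -> q x = q y -> x = y.
Proof.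
move=> Ss sx sy; have [_ inj _] := qbij.
by apply: inj; rewrite inE; exists s.
Qed.

(* [d] is the difference of the points [d + w] and [w] of the cone, for [w] far
   inside. *)
Lemma q_span_inj E I d : E \in unitmx -> Sigma (lattice_cone E I) ->
  (forall j, j \notin I -> lcoord E d 0 j = 0) -> q d = 0 -> d = 0.
Proof.
move=> uE SE dI qd.
pose M := \sum_j `|lcoord E d 0 j|.
have M0 : 0 <= M by apply: sumr_ge0.
pose w := \sum_(j in I) M *: lrow R E j.
have wE j : lcoord E w 0 j = (j \in I)%:R * M.
  have -> : lcoord E w 0 j = \sum_(i in I) M * (i == j)%:R.
    rewrite /lcoord /w mulmx_suml summxE; apply: eq_bigr => i _.
    by rewrite -scalemxAl mxE -/(lcoord E (lrow R E i)) lcoord_lrow_id// mxE eqxx eq_sym.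
  have [jI|jI] := boolP (j \in I).
    rewrite (bigD1 j)//= eqxx big1 ?addr0 ?mulr1 ?mul1r// => i /andP[_ /negPf->].
    by rewrite mulr0.
  rewrite mul0r big1// => i iI; case: eqP => [ij|]; last by rewrite mulr0.
  by rewrite -ij iI in jI.
have sw : lattice_cone E I w.
  apply/(lattice_coneP _ _ uE) => j; rewrite wE; split; first by rewrite mulr_ge0.
  by move=> /negPf->; rewrite mul0r.
have sdw : lattice_cone E I (d + w).
  apply/(lattice_coneP _ _ uE) => j; rewrite -[d]scale1r lcoordP scale1r mxE wE.
  split; last by move=> jI; rewrite dI// (negPf jI) mul0r addr0.
  have [jI|jI] := boolP (j \in I); last by rewrite dI// mul0r addr0.
  have : `|lcoord E d 0 j| <= M.
    by rewrite /M (bigD1 j)//= lerDl sumr_ge0.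
  by rewrite mul1r ler_norml => /andP[H _]; rewrite -lerBlDr sub0r.
have qdw : q (d + w) = q w by rewrite linearD /= qd add0r.
have := q_inj SE sdw sw qdw => /eqP.
by rewrite eq_sym -subr_eq subrr eq_sym => /eqP.
Qed.

(** Since q is injective on the span of the cone, the preimages of the given points lie on one line
    through a preimage of [y]. If that preimage had a negative coordinate, so would the preimages
    close to it. *)
Lemma image_cone_closed s (y v : W) : Sigma s ->
  (forall K, exists2 k, (K <= k)%N & (q @` s) (y + (k.+1%:R : R)^-1 *: v)) ->
  (q @` s) y.
Proof.
move=> Ss; have [E [I [uE sE]]] := Sfan.2 s Ss; rewrite sE in Ss *.
pose e (k : nat) := (k.+1%:R : R)^-1.
rewrite -/(e _) => H.
have [k1 _ [x1 s1 q1]] := H 0%N; have [k2 k12 [x2 s2 q2]] := H k1.+1.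
have e12 : e k1 - e k2 != 0.
  rewrite subr_eq0 /e; apply/eqP => /invr_inj/eqP; rewrite eqr_nat eqSS => /eqP kk.
  by rewrite kk ltnn in k12.
(* Two of the points determine the line: [xv] lies over the direction [v], and [xy] over [y]. *)
pose xv := (e k1 - e k2)^-1 *: (x1 - x2).
pose xy := x1 - e k1 *: xv.
have qv : q xv = v.
  rewrite linearZ linearB /= q1 q2 opprD addrACA subrr add0r -scalerBl scalerA.
  by rewrite mulVf// scale1r.
have qy : q xy = y by rewrite linearB linearZ /= qv q1 addrK.
have out (x : 'rV[R]_n) j : lattice_cone E I x -> j \notin I -> lcoord E x 0 j = 0.
  by move=> /(lattice_coneP _ _ uE) /(_ j)[_].
have lB (x x' : 'rV[R]_n) : lcoord E (x - x') = lcoord E x - lcoord E x' by rewrite /lcoord mulmxBl.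
have lZ (c : R) (x : 'rV[R]_n) : lcoord E (c *: x) = c *: lcoord E x by rewrite /lcoord -scalemxAl.
have vout j : j \notin I -> lcoord E xv 0 j = 0.
  move=> jI; have := out _ _ s1 jI; have := out _ _ s2 jI.
  rewrite /xv lZ lB; move: (lcoord E x1) (lcoord E x2) => A B HB HA.
  by rewrite !mxE HA HB subrr mulr0.
have yout j : j \notin I -> lcoord E xy 0 j = 0.
  move=> jI; rewrite /xy lB lZ.
  move: (lcoord E x1) (lcoord E xv) (out _ _ s1 jI) (vout _ jI) => A B HA HB.
  by rewrite !mxE HA HB mulr0 subrr.
clearbody xy xv.
exists xy => //; apply/(lattice_coneP _ _ uE) => j; split; last exact: yout.
rewrite leNgt; apply/negP => y0.
set a := lcoord E xy 0 j in y0; set b := lcoord E xv 0 j.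
(* From this index on, b / (k + 1) < - a, so the coordinate a + b / (k + 1) is still negative. *)
have [k Hk [x sx qx]] := H (Num.truncn (b / - a)).+1.
have xE : x = xy + e k *: xv.
  apply/eqP; rewrite -subr_eq0; apply/eqP; apply: (q_span_inj uE Ss) => [i iI|].
    rewrite opprD addrA !lB lZ.
    move: (lcoord E x) (lcoord E xv) (lcoord E xy) (out _ _ sx iI) (vout _ iI)
      (yout _ iI) => A B A' HA HB HA'.
    by rewrite !mxE HA HB HA' mulr0 !subrr.
  by rewrite linearB linearD linearZ /= qx qy qv subrr.
have /(lattice_coneP _ _ uE) /(_ j)[+ _] := sx.
rewrite xE addrC lcoordP /e; move: (lcoord E xy) (lcoord E xv) @a @b y0 Hk.
move=> A B a b y0 Hk; rewrite !mxE -/a -/b; apply/negP; rewrite -ltNge.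
rewrite -ltrBrDr sub0r mulrC ltr_pdivrMr ?ltr0n// mulrC -ltr_pdivrMr ?oppr_gt0//.
apply: lt_le_trans (Num.Theory.truncnS_gt _) _; rewrite ler_nat.
exact: leq_trans Hk (leqnSn _).
Qed.

Lemma in_max_cone (y : W) : exists2 s, max_cone SS s & s y.
Proof.
have [fin poly _ _] := Wfan.
have [v [s [ms Hs]]] := max_cone_near y fin (fun s Hs => (poly s Hs).1) Wcomplete.
exists s => //; have [[s0 S0 s0E] _] := ms.
by rewrite -s0E; apply: (image_cone_closed (v := v) S0); rewrite s0E.
Qed.

Lemma linform_qP (f : 'Hom(W, R^o)) c x1 x2 :
  (f (q (c *: x1 + x2)) : R) = c * (f (q x1) : R) + (f (q x2) : R).
Proof. by rewrite linearP linearP. Qed.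

Variables (p : nat) (v : 'I_p -> W) (b : 'I_p -> R).
Hypothesis vgen : ray_generators SS v.

(** On a ray generator v_i in the cone, the vertex takes the value - b_i, the least that the
    polyhedron allows. Every lattice generator of the preimage cone maps to a nonnegative multiple
    of such a v_i. *)
Lemma vertex_minimal s (u u' : 'Hom(W, R^o)) y : max_cone SS s ->
  vertex v b s u -> polyhedron v b u' -> s y -> (u y : R) <= u' y.
Proof.
move=> [[s0 S0 <-] _] Hu Hu' [x sx <-].
have [E [I [uE sE]]] := Sfan.2 s0 S0; rewrite sE in S0 sx Hu *.
rewrite -subr_ge0.
apply: (lattice_cone_ge0 (phi := fun x => (u' (q x) : R) - u (q x)) _ _ _ sx).
- by rewrite linear0 (linear0 u) (linear0 u') subr0.
- by move=> c x1 x2; rewrite !linform_qP; ring.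
move=> j jI.
have Sj : Sigma (lattice_cone E [set j]).
  have [[_ _ Sface _] _] := Sfan.
  apply: (Sface _ _ S0); exact: (face_lattice_ray R uE jI).
have cj : lattice_cone E [set j] = cone [:: lrow R E j].
  by rewrite /lattice_cone /image_mem enum_set1.
have qcj : q @` lattice_cone E [set j] = cone [:: q (lrow R E j)].
  rewrite cj eqEsubset; split=> [_ [x1 /cone1E[c c0 ->] <-]|x1 /cone1E[c c0 ->]].
    by rewrite linearZ; apply/cone1E; exists c.
  by exists (c *: lrow R E j); [apply/cone1E; exists c|rewrite linearZ].
have nz : q (lrow R E j) != 0.
  apply/eqP => /(q_span_inj uE S0) H.
  have : lrow R E j = 0.
    apply: H => i iI; rewrite lcoord_lrow_id// mxE eqxx /=.
    by case: eqP iI => // ->; rewrite jI.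
  move/(congr1 (fun x => lcoord E x 0 j)); rewrite lcoord_lrow_id// /lcoord mul0mx !mxE !eqxx.
  by move/eqP; rewrite oner_eq0.
have [_ _ vsurj] := vgen.
have [i _ Hi] : [set cone [:: v i] | i in setT] (q @` lattice_cone E [set j]).
  apply: vsurj.
  split; first by exists (lattice_cone E [set j]).
  rewrite qcj; have := lin_dim_cone [:: q (lrow R E j)].
  by rewrite span_seq1 dim_vline nz.
rewrite /= qcj in Hi.
have [c c0 qE] : exists2 c : R, 0 <= c & q (lrow R E j) = c *: v i.
  by apply/cone1E; rewrite Hi; apply: cone_mem; rewrite inE.
have vi : (q @` lattice_cone E I) (v i).
  have /cone1E[d d0 ->] : cone [:: q (lrow R E j)] (v i).
    by rewrite -Hi; apply: cone_mem; rewrite inE.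
  exists (d *: lrow R E j); last by rewrite linearZ.
  rewrite -[_ *: _]addr0; apply: cone_scale_add => //; last exact: cone0.
  exact: lattice_cone_mem.
have E1 := Hu i vi; have E2 := Hu' i.
have lE (f : 'Hom(W, R^o)) : (f (q (lrow R E j)) : R) = c * (f (v i) : R).
  by rewrite qE linearZ.
rewrite (lE u) (lE u') -mulrBr mulr_ge0//.
by move: E1 E2 => /=; move: (u (v i) : R) (u' (v i) : R) => e1 e2; lra.
Qed.

(** Take a maximal cone [t] through the image of the sum [y] of the generators. The form cutting out
    the common face is nonnegative on each generator and zero on their sum, so zero on all: the face
    is the whole image cone. *)
Lemma image_in_max_cone s : Sigma s ->
  exists2 t, max_cone SS t & q @` s `<=` t.
Proof.
move=> Ss; have [E [I [uE sE]]] := Sfan.2 s Ss.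
pose y := \sum_(j in I) lrow R E j.
have sy : s y.
  rewrite sE /y; elim/big_ind : _ => [|x1 x2 H1 H2|j jI].
  - exact: cone0.
  - by rewrite -[x1]scale1r; apply: cone_scale_add.
  - exact: lattice_cone_mem.
have [t mt ty] := in_max_cone (q y); exists t => //.
have [_ _ _ inter] := Wfan.
have [[f [f0 fE]] _] := inter (q @` s) t (ex_intro2 _ _ s Ss erefl) mt.1.
have fy : f (q y) = 0.
  have : (q @` s `&` t) (q y) by split => //; exists y.
  by rewrite fE => -[].
have fj j : j \in I -> f (q (lrow R E j)) = 0.
  move=> jI; move: fy; rewrite /y !linear_sum /= => fy.
  apply: (psumr_eq0P _ fy) => // i iI; apply: f0; exists (lrow R E i) => //.
  by rewrite sE; exact: lattice_cone_mem.
move=> _ [x sx <-].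
suff : (q @` s `&` t) (q x) by case.
rewrite fE; split; first by exists x.
rewrite sE in sx; apply/eqP; rewrite eq_le; apply/andP; split; last first.
  by apply: f0; exists x => //; rewrite sE.
rewrite -oppr_ge0.
apply: (lattice_cone_ge0 (phi := fun x => - (f (q x) : R)) _ _ _ sx).
- by rewrite linear0 (linear0 f) oppr0.
- by move=> c x1 x2; rewrite !linform_qP; ring.
- by move=> j /fj ->; rewrite oppr0.
Qed.

End FanData.

Section LinearForms.
Variables (R : realType) (W : vectType R).

Lemma linform_sep (y : W) : (forall f : 'Hom(W, R^o), f y = 0) -> y = 0.
Proof.
move=> H; rewrite (coord_vbasis (memvf y)) big1// => i _.
have := H (linfun (coord (vbasis fullv) i : W -> R^o)).
by rewrite lfunE /= => ->; rewrite scale0r.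
Qed.

(** Evaluation at [y] kills all differences of elements of [A], which span the dual space. *)
Lemma aff_dim_full_sep (A : set 'Hom(W, R^o)) (y : W) :
  aff_dim A (\dim {: 'Hom(W, R^o)}) ->
  (forall f g, A f -> A g -> f y = g y) -> y = 0.
Proof.
move=> [U [_ minU dU]] HA; apply: linform_sep => f.
pose ev (f : 'Hom(W, R^o)) : R^o := f y.
have ev_lin : linear ev.
  by move=> c g1 g2; rewrite /ev add_lfunE scale_lfunE.
pose evL := GRing.isLinear.Build R 'Hom(W, R^o) R^o _ ev ev_lin.
pose ev' : {linear 'Hom(W, R^o) -> R^o} := HB.pack ev evL.
have evE g : linfun ev' g = g y := lfunE ev' g.
have UK : (U <= lker (linfun ev'))%VS.
  apply: minU => _ [g1 A1 [g2 A2 <-]]; rewrite memv_ker linearB /=.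
  by rewrite (evE g1) (evE g2) (HA g1 g2)// subrr.
have UF : U = fullv by apply/eqP; rewrite eqEdim subvf dU /=.
have : f \in lker (linfun ev') by apply: (subvP UK); rewrite UF memvf.
by rewrite memv_ker => /eqP; rewrite (evE f).
Qed.

End LinearForms.

(** * Minimizing forms and the scaling constant *)

Section Minimizers.
Variables (R : realType) (n : nat) (Sigma : set (set 'rV[R]_n)).
Variables (W : vectType R) (q : 'Hom('rV[R]_n, W)).
Local Notation SS := [set q @` s | s in Sigma].
Hypothesis Sfan : regular_fan Sigma.
Hypothesis Wfan : is_fan SS.
Hypothesis Wcomplete : complete_fan SS.
Hypothesis qbij : set_bij (\bigcup_(s in Sigma) s) setT q.
Hypothesis Wnormal : weakly_normal SS.

Lemma fan_minimizers : exists (r : nat) (u : 'I_r -> 'Hom(W, R^o)),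
  (forall s, Sigma s -> exists i, forall y, s y ->
     forall j, (u i (q y) : R) <= u j (q y)) /\
  (forall y : W, (forall i j, u i y = u j y) -> y = 0).
Proof.
have [p [v [b [vgen Hmax Hdim]]]] := Wnormal.
have Hu s : exists u : 'Hom(W, R^o), max_cone SS s -> vertex v b s u /\ polyhedron v b u.
  by have [/Hmax[u Hs]|ns] := pselect (max_cone SS s); [exists u|exists 0].
have {Hu} [us Hus] := choice Hu.
have [/finite_seqP[ss SSE] _ _ _] := Wfan.
pose mx := [seq s <- ss | `[< max_cone SS s >]].
have mxP s : s \in mx <-> max_cone SS s.
  rewrite mem_filter; split=> [/andP[/asboolP ms _]|ms]; first exact: ms.
  rewrite asboolT//=; have [SSs _] := ms.
  by rewrite SSE in SSs.
pose u (i : 'I_(size mx)) := us (nth set0 mx i).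
have umx (i : 'I_(size mx)) : max_cone SS (nth set0 mx i) by apply/mxP; exact: mem_nth.
have uex s : max_cone SS s -> exists i, u i = us s.
  move=> /mxP ms; have im : (index s mx < size mx)%N by rewrite index_mem.
  by exists (Ordinal im); rewrite /u /= nth_index.
have minimal s y f : max_cone SS s -> s y -> polyhedron v b f -> (us s y : R) <= f y.
  by move=> ms sy Hf; apply: (vertex_minimal Sfan qbij vgen ms (Hus s ms).1 Hf sy).
exists (size mx), u; split=> [s Ss|y Hy].
  have [t mt st] := image_in_max_cone Sfan Wfan Wcomplete qbij Ss.
  have [i ui] := uex t mt; exists i => y sy j; rewrite ui.
  by apply: (minimal t) => //; [apply: st; exists y|exact: (Hus _ (umx j)).2].
(* Over the polyhedron, the pairing with [y] is least at the vertex of a cone containing [y] and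
   greatest at that of a cone containing [- y]. If the two values agree, the pairing is constant on
   a set of full dimension. *)
have [s ms sy] := in_max_cone Sfan Wfan Wcomplete qbij y.
have [t mt ty] := in_max_cone Sfan Wfan Wcomplete qbij (- y).
have [i ui] := uex s ms; have [j uj] := uex t mt.
apply: (aff_dim_full_sep Hdim).
have H f : polyhedron v b f -> f y = us s y.
  move=> Pf; have H1 := minimal s y f ms sy Pf.
  have := minimal t (- y) f mt ty Pf; rewrite !linearN /= lerN2 => H2.
  apply: le_anti; rewrite H1 andbT; apply: le_trans H2 _.
  by rewrite -uj -ui (Hy j i).
by move=> f g /H-> /H->.
Qed.

End Minimizers.

Section Scaling.
Variables (R : realType) (n r : nat) (L : 'M[R]_(n, r)).
Variable Sigma : set (set 'rV[R]_n).

(** Stated for any [M] so that its instance for [N^-1] and [N *: L] supplies the reverse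
    inequality. *)
Lemma excessZ_le (N : R) s (M : 'M[R]_(n, r)) x : 0 <= N ->
  excess (N *: M) s x <= N * excess M s x.
Proof.
move=> N0; apply: excess_le => [|t]; first by rewrite mulr_ge0// excess_ge0.
rewrite -scalemxAr; move: (excess_ge M s t x); move: (x *m M) => A H.
by rewrite !mxE -mulrBr ler_wpM2l.
Qed.

Lemma excessZ (N : R) s x : 0 < N -> excess (N *: L) s x = N * excess L s x.
Proof.
move=> N0; have N0' := ltW N0; apply/eqP; rewrite eq_le excessZ_le//=.
rewrite -ler_pdivlMl//.
have := @excessZ_le N^-1 s (N *: L) x.
by rewrite scalerA mulVf ?gt_eqF// scale1r; apply; rewrite invr_ge0 ltW.
Qed.

Hypothesis Sfan : regular_fan Sigma.
Hypothesis Smin : forall s, Sigma s ->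
  exists i, forall y, s y -> forall j, (y *m L) 0 i <= (y *m L) 0 j.

Lemma eventually_le (a : R) : 0 < a ->
  exists K, forall k, (K <= k)%N -> (k.+1%:R : R)^-1 <= a.
Proof.
move=> a0; exists (Num.truncn a^-1) => k Kk.
rewrite -[leRHS]invrK lef_pV2 ?posrE ?ltr0n ?invr_gt0//.
by apply: ltW; apply: lt_le_trans (Num.Theory.truncnS_gt _) _; rewrite ler_nat.
Qed.

(* The generators of a cone have nonnegative integer coordinates in any lattice
   basis defining the same cone, so one basis per cone bounds the excess. *)
Lemma excess_gap : exists K : nat, forall E I j s, E \in unitmx ->
  Sigma (lattice_cone E I) -> j \in I ->
  excess L s (lrow R E j) = 0 \/ (K.+1%:R : R)^-1 <= excess L s (lrow R E j).
Proof.
have [[/finite_seqP[ss SSE] _ _ _] reg] := Sfan.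
have H c : c \in ss -> exists K, forall k, (K <= k)%N -> forall E I j s, E \in unitmx ->
  lattice_cone E I = c -> j \in I ->
  excess L s (lrow R E j) = 0 \/ (k.+1%:R : R)^-1 <= excess L s (lrow R E j).
  move=> css; have Sc : Sigma c by rewrite SSE.
  have [E0 [I0 [uE0 cE]]] := reg c Sc; have [i0 Hi0] := Smin Sc.
  have HF (p : 'I_r * 'I_n) : p \in enum {: 'I_r * 'I_n} ->
      exists K, forall k, (K <= k)%N ->
      excess L p.1 (lrow R E0 p.2) != 0 -> (k.+1%:R : R)^-1 <= excess L p.1 (lrow R E0 p.2).
    move=> _; have [->|e0] := eqVneq (excess L p.1 (lrow R E0 p.2)) 0.
      by exists 0%N => k _.
    have [|K HK] := @eventually_le (excess L p.1 (lrow R E0 p.2)).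
      by rewrite lt_neqAle eq_sym e0 excess_ge0.
    by exists K => k /HK.
  have [K HK] := eventually_seq HF.
  exists K => k Kk E I j s uE EI jI.
  have cj : c (lrow R E j) by rewrite -EI; exact: lattice_cone_mem.
  have ex0 y : c y -> excess L i0 y = 0 by move=> cy; apply: excess_eq0; exact: Hi0.
  (* On this cone the form [i0] is the minimum, so the excess is linear there and can be expanded in
     the generators. *)
  have exE y : c y -> excess L s y = (y *m L) 0 s - (y *m L) 0 i0.
    by move=> cy; rewrite -excessB ex0// subr0.
  pose co := lcoord E0 (lrow R E j).
  have coP i : 0 <= co 0 i /\ (i \notin I0 -> co 0 i = 0).
    by move: cj; rewrite cE => /(lattice_coneP _ _ uE0); apply.
  have co_int i : co 0 i != 0 -> 1 <= co 0 i.
    have [+ _] := coP i; rewrite /co lcoord_lrow mxE.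
    move: ((row j E *m _) 0 i) => z; rewrite ler0z intr_eq0 => z0 zn.
    by rewrite ler1z -gtz0_ge1 lt_neqAle eq_sym zn.
  have sum_co : excess L s (lrow R E j) = \sum_(i in I0) co 0 i * excess L s (lrow R E0 i).
    rewrite exE// {1 2}(lcoordE (lrow R E j) uE0) -/co !mulmx_suml !summxE -sumrB.
    rewrite [RHS]big_mkcond; apply: eq_bigr => i _; have [_ ci] := coP i.
    rewrite -!scalemxAl.
    have [iI|/ci->] := boolP (i \in I0); last by rewrite !scale0r !mxE subrr.
    rewrite exE; last by rewrite cE; exact: lattice_cone_mem.
    by move: (lrow R E0 i *m L) => A; rewrite !mxE -mulrBr.
  have term0 i : 0 <= co 0 i * excess L s (lrow R E0 i).
    by rewrite mulr_ge0 ?excess_ge0//; have [] := coP i.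
  have [/eqP->|nz] := boolP (excess L s (lrow R E j) == 0); [by left|right].
  have [i iI ti] : exists2 i, i \in I0 & co 0 i * excess L s (lrow R E0 i) != 0.
    apply: contrapT => Hn; move/eqP: nz; apply; rewrite sum_co big1// => i iI.
    by apply/eqP/negPn/negP => ti; apply: Hn; exists i.
  (* All terms are nonnegative, and this one has an integer coefficient at least 1. *)
  rewrite sum_co (bigD1 i)//= -[leLHS]addr0; apply: lerD; last by apply: sumr_ge0.
  move: ti; rewrite mulf_eq0 negb_or => /andP[/co_int c1 e0].
  have H1 := HK k Kk (s, i) (mem_enum _ _) e0.
  by apply: le_trans H1 _; rewrite ler_peMl// excess_ge0.
have [K HK] := eventually_seq H; exists K => E I j s uE SE jI.
by apply: (HK K (leqnn K) _ _ E I j s uE erefl jI); rewrite SSE in SE.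
Qed.

End Scaling.

Theorem theorem5p6 (R : realType) (n : nat) (Sigma : set (set 'rV[R]_n))
  (h : {vspace 'rV[R[i]]_n}) (W : vectType R) (q : 'Hom('rV[R]_n, W)) :
  regular_fan Sigma ->
  (forall x : 'rV[R]_n, map_mx (real_complex R) x \in h -> x = 0) ->
  (* [W], with [q], is the quotient of [t] by [p(h)] *)
  limg q = fullv ->
  (forall x : 'rV[R]_n, q x = 0 <-> real_part h x) ->
  is_fan [set q @` s | s in Sigma] ->
  complete_fan [set q @` s | s in Sigma] ->
  set_bij (\bigcup_(s in Sigma) s) setT q ->
  weakly_normal [set q @` s | s in Sigma] ->
  forall k : nat, exists w : two_tensor (quotient_manifold Sigma h),
    [/\ two_form w, Ck_form k w, type11 w &
        transverse_kahler_on (M := quotient_manifold Sigma h) (open_orbit h)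
          (@canonical_foliation R n Sigma h) w].
Proof.
move=> Sfan _ _ qker Wfan Wcomplete qbij Wnormal k.
have [r [u [umin usep]]] := fan_minimizers Sfan Wfan Wcomplete qbij Wnormal.
pose L1 : 'M[R]_(n, r) := \matrix_(i, s) (u s (q (delta_mx 0 i)) : R).
have L1E (x : 'rV[R]_n) s : (x *m L1) 0 s = u s (q x).
  rewrite mxE [in RHS](row_sum_delta x) !linear_sum /=; apply: eq_bigr => i _.
  by rewrite mxE linearZ /= linearZ.
have [|K HK] := excess_gap (L := L1) Sfan.
  move=> s /umin[i Hi]; exists i => y sy j; rewrite !L1E; exact: Hi.
(* The factor [K.+1] raises the gap of [excess_gap] to 1; then [k.+2] puts every nonzero exponent
   strictly above [k.+1]. *)
pose N : R := K.+1%:R * k.+2%:R.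
have N0 : 0 < N by rewrite mulr_gt0 ?ltr0n.
pose L := N *: L1.
have LE (x : 'rV[R]_n) s : (x *m L) 0 s = N * u s (q x).
  by rewrite /L -scalemxAr mxE L1E.
have hL (x : 'rV[R]_n) : real_part h x -> x *m L = 0.
  move=> /qker qx; apply/rowP => s; rewrite LE qx.
  by rewrite (linear0 (u s)) mulr0 mxE.
have hker (x : 'rV[R]_n) : (forall s t, (x *m L) 0 s = (x *m L) 0 t) -> real_part h x.
  move=> H; apply/qker; apply: usep => i j; have := H i j.
  by rewrite !LE => /(mulfI (lt0r_neq0 N0)).
have hmin B I : B \in unitmx -> Sigma (lattice_cone B I) ->
    exists s : 'I_r, forall j, j \in I -> excess L s (lrow R B j) = 0.
  move=> uB SB; have [i Hi] := umin _ SB; exists i => j jI.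
  rewrite excessZ// excess_eq0 ?mulr0// => t; rewrite !L1E; apply: Hi.
  exact: lattice_cone_mem.
have hbig B I : B \in unitmx -> Sigma (lattice_cone B I) ->
    forall j s, j \in I -> excess L s (lrow R B j) = 0 \/
      k.+1%:R < excess L s (lrow R B j).
  move=> uB SB j s jI; rewrite !excessZ//.
  have [->|H] := HK B I j s uB SB jI; first by left; rewrite mulr0.
  right; apply: (@lt_le_trans _ _ k.+2%:R); first by rewrite ltr_nat.
  rewrite /N mulrAC -[leLHS]mul1r ler_pM2r ?ltr0n//.
  by rewrite -ler_pdivrMl ?ltr0n// mulr1.
exists (kahler_tensor L); split.
- exact: kahler_tensor_two_form.
- exact: kahler_tensor_Ck.
- exact: kahler_tensor_type11.
move=> c x cx [t t0 Ht].
have z0 := open_orbit_neq0 (slice_unit c) t0 Ht.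
split; first exact: kahler_tensor_closed.
move=> X; rewrite /kahler_tensor linearZ /=; split; first exact: kform_J_ge0.
exact: (kform_kernel hL hker _ (slice_unit c) z0).
Qed.
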